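(* The three sets of partitions $\mathfrak{EO}^{(1)}$, $\mathfrak{EO}^{(2)}$ and $\mathfrak{EO}^{(3)}$ are all stable. Furthermore, writing $\mathcal{EO}^{(i)}(n)$ for the number of partitions of $n$ in $\mathfrak{EO}^{(i)}$, we have $$\sum_{n=1}^\infty\mathcal{EO}^{(2)}(n)q^n=\frac{1}{2}q\big(\nu(q)+\nu(-q)\big),$$ $$\sum_{n=1}^\infty\mathcal{EO}^{(3)}(n)q^n=q\,\omega(q^2).$$
   Context: A partition of $n$ is a finite weakly decreasing sequence of positive integers (its parts) with sum $n$; the empty partition $\epsilon$ of $0$ is allowed. The conjugate $\lambda'$ is obtained by transposing the Ferrers graph of $\lambda$. A set $\mathfrak{C}$ of partitions is called stable if for every partition $\lambda$: $\lambda\in\mathfrak{C}$ if and only if $\lambda'\in\mathfrak{C}$. $\mathfrak{EO}$ is the set of partitions in which every even part is less than each odd part (a condition that holds vacuously if all parts have the same parity, or if the partition is empty). Say that a part size appears an odd number of times (aont) in $\lambda$ if its multiplicity in $\lambda$ is odd. Then: $\mathfrak{EO}^{(1)}$ is the set of $\lambda\in\mathfrak{EO}$ such that at most one part size of $\lambda$ aont; $\mathfrak{EO}^{(2)}$ is the set of $\lambda\in\mathfrak{EO}$ such that only the smallest odd part of $\lambda$ aont (so $\lambda$ has an odd part, its smallest odd part has odd multiplicity, and all other occurring part sizes have even multiplicity); $\mathfrak{EO}^{(3)}$ is the set of $\lambda\in\mathfrak{EO}$ such that all parts of $\lambda$ are odd and only the largest odd part of $\lambda$ aont (so $\lambda$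 is nonempty, its largest part has odd multiplicity, and all other occurring part sizes have even multiplicity). In particular $\epsilon\notin\mathfrak{EO}^{(2)}\cup\mathfrak{EO}^{(3)}$. With $(a;q)_n=\prod_{j=0}^{n-1}(1-aq^j)$ and $|q|<1$, the third order mock theta functions are $$\nu(q)=\sum_{n=0}^{\infty}\frac{q^{n^2+n}}{(-q;q^2)_{n+1}},\qquad \omega(q)=\sum_{n=0}^{\infty}\frac{q^{2n^2+2n}}{(q;q^2)_{n+1}^2}.$$ *)

(* Defs.v *)
From HB Require Import structures.
From mathcomp Require Import all_boot all_order all_algebra.
From mathcomp Require Import finmap.
From mathcomp Require Import complex.
From mathcomp Require Import boolp classical_sets cardinality.
From mathcomp Require Import reals topology normedtype sequences.

Set Implicit Arguments.
Unset Strict Implicit.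
Unset Printing Implicit Defensive.

Import Order.TTheory GRing.Theory Num.Theory.
Import numFieldNormedType.Exports.

Local Open Scope classical_set_scope.

(* Partitions are sequences of positive natural numbers in weakly decreasing
   order; the empty partition is [::]. *)
Definition is_part : set (seq nat) :=
  [set la | sorted geq la /\ forall a, a \in la -> 0 < a].

(* The j-th part of the conjugate (j counted from 0) is the length of the j-th
   column of the Ferrers graph {(i, j) | j < la_i}. *)
Definition conj_part (la : seq nat) : seq nat :=
  mkseq (fun j => count (fun a => j < a) la) (head 0 la).

Definition stable (C : set (seq nat)) : Prop :=
  forall la, is_part la -> (C la <-> C (conj_part la)).

Definition aont (la : seq nat) (a : nat) : Prop := odd (count_mem a la).

Definition smallest_odd (la : seq nat) (a : nat) : Prop :=
  [/\ a \in la, odd a & forall b, b \in la -> odd b -> a <= b].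

Definition largest_odd (la : seq nat) (a : nat) : Prop :=
  [/\ a \in la, odd a & forall b, b \in la -> odd b -> b <= a].

Definition EO : set (seq nat) :=
  [set la | is_part la /\
    forall a b, a \in la -> b \in la -> ~~ odd a -> odd b -> a < b].

Definition EO1 : set (seq nat) :=
  [set la | EO la /\ forall a b, aont la a -> aont la b -> a = b].

Definition EO2 : set (seq nat) :=
  [set la | EO la /\
    exists2 a, smallest_odd la a & forall b, aont la b <-> b = a].

Definition EO3 : set (seq nat) :=
  [set la | [/\ EO la, (forall a, a \in la -> odd a) &
    exists2 a, largest_odd la a & forall b, aont la b <-> b = a]].

(* [fset_set] is only meaningful on finite sets: see [finite_part_of]. *)
Definition nb_part (C : set (seq nat)) (n : nat) : nat :=
  #|` fset_set [set la | [/\ is_part la, sumn la = n & C la]]|.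

Lemma finite_part_of (C : set (seq nat)) (n : nat) :
  finite_set [set la | [/\ is_part la, sumn la = n & C la]].
Proof.
pose f (s : n.-bseq 'I_n.+1) : seq nat := [seq val i | i <- s].
apply: (@sub_finite_set _ _ (f @` [set: n.-bseq 'I_n.+1])); last first.
  by apply: finite_image; exact: finite_finset.
move=> la [[_ la_gt0] sum_la _] /=.
have la_le a : a \in la -> a < n.+1.
  by rewrite -sum_la => /perm_to_rem/perm_sumn -> /=; rewrite ltnS leq_addr.
have sz : size [seq inord a : 'I_n.+1 | a <- la] <= n.
  rewrite size_map -sum_la; elim: la la_gt0 {sum_la la_le} => //= a s IHs h.
  rewrite -add1n leq_add ?h ?mem_head // IHs // => b bs.
  by rewrite h // in_cons bs orbT.
exists (Bseq sz) => //; rewrite /f /= -map_comp -[RHS]map_id.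
by apply/eq_in_map => a /la_le al /=; rewrite inordK.
Qed.

Lemma conj_partP (la : seq nat) : is_part la ->
  is_part (conj_part la) /\
  forall i j, (i < nth 0 (conj_part la) j) = (j < nth 0 la i).
Proof.
move=> [la_sorted la_gt0].
have cntE i j : (i < count (fun a => j < a) la) = (j < nth 0 la i).
  elim: la la_sorted {la_gt0} i => [|a s IHs] /= ps i; first by rewrite nth_nil.
  have {}IHs := IHs (path_sorted ps).
  have /allP le_a : all (geq a) s.
    by apply: order_path_min ps => x y z /= xy yz; apply: leq_trans xy.
  have [ja|aj] /= := ltnP j a.
    by case: i => [|i] /=; [rewrite add1n ltnS leq0n ja | rewrite add1n ltnS].
  rewrite add0n (_ : count _ s = 0) => [|].
    rewrite ltn0; case: i => [|i] /=; first by rewrite ltnNge aj.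
    apply/esym/negbTE; rewrite -leqNgt.
    have [si|si] := leqP (size s) i; first by rewrite nth_default.
    by apply: leq_trans aj; apply: le_a; rewrite mem_nth.
  apply/eqP; rewrite -leqn0 leqNgt -has_count; apply/hasPn => b /le_a /= ba.
  by rewrite -leqNgt (leq_trans ba).
split; last first.
  move=> i j; have [jm|mj] := ltnP j (head 0 la).
    by rewrite nth_mkseq // cntE.
  rewrite nth_default ?size_mkseq // ltn0 -cntE; apply/esym/negbTE.
  rewrite -leqNgt (leq_trans _ (leq0n i)) // leqNgt cntE nth0 -leqNgt //.
split.
  apply/(sortedP 0) => j; rewrite size_mkseq => jm.
  rewrite !nth_mkseq ?(ltnW jm) //= /geq /=.
  by apply: sub_count => a /= /ltnW.
by move=> a /mapP[j]; rewrite mem_iota add0n => /= jm ->; rewrite cntE nth0.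
Qed.

Local Open Scope ring_scope.

Section MockTheta.
Variable R : realType.
Local Notation C := (R[i] : numFieldType).
Implicit Types a q : C.

Definition qpoch a q (n : nat) : C := \prod_(0 <= j < n) (1 - a * q ^+ j).

Definition nu q : C :=
  limn (series (fun n => q ^+ (n ^ 2 + n) / qpoch (- q) (q ^+ 2) n.+1)).

Definition omega q : C :=
  limn (series (fun n =>
    q ^+ (2 * n ^ 2 + 2 * n) / qpoch q (q ^+ 2) n.+1 ^+ 2)).

End MockTheta.

(* Main.v *)
Require Import Defs.
From mathcomp Require Import all_boot all_order all_algebra.
From mathcomp Require Import finmap complex.
From mathcomp Require Import boolp classical_sets cardinality.
From mathcomp Require Import reals topology normedtype sequences.
From mathcomp Require Import ring zify.

(* Stability.  The multiplicities of the parts of a partition are the differences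
   of consecutive parts of its conjugate.  Hence "at most one part size appears an
   odd number of times" is exactly the condition EO for the conjugate, and each of
   the three sets is described by parity conditions on a partition and its
   conjugate that are symmetric in the two.

   Generating functions.  Put z = q^2, and let all q-products have base z^2.
   Reading off the multiplicities, EO2 and EO3 have the generating functions
     q / (z)_oo * sum_n (z)_n z^n / (z^2)_n   and   q * sum_n z^n / (z)_{n+1}.
   Both sums are specialisations of the Rogers-Fine function and satisfy a
   first-order recurrence under s |-> s z^2, s being the base point of the upper,
   resp. lower, factorial.  Iterating it turns the first sum into
   psi = sum_n q^(n^2+n) and the second one into omega(z).
   Finally put nu(q; y) = sum_n q^(n^2+n) / (-y; q^2)_{n+1}, so that nu(q) and
   nu(-q) are the values at y = q and y = -q.  From
     (1 - y^2) nu(q; y) = nu(q; y q^2) - y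
   the odd term cancels in T(y) = nu(q; y) + nu(q; -y), so that
   (1 - y^2) T(y) = T(y q^2).  Iterating from y = q gives
   (z)_oo (nu(q) + nu(-q)) = T(0) = 2 psi. *)

Set Implicit Arguments.
Unset Strict Implicit.
Unset Printing Implicit Defensive.

Import Order.TTheory GRing.Theory Num.Theory.
Import numFieldNormedType.Exports.

Local Open Scope classical_set_scope.
Local Open Scope ring_scope.

(** * Absolutely convergent series *)

(* The only completeness property needed; [R[i]] carries no complete-space
   instance in the library, so it is isolated here and proved for [R[i]] below. *)
Definition abs_complete (K : numFieldType) : Prop :=
  forall (u : nat -> K) (B : K),
    (forall n, \sum_(0 <= k < n) `|u k| <= B) -> cvgn (series u).

Section ComplexComplete.
Variable R : realType.
Local Notation C := (R[i] : numFieldType).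

Lemma cvg_real_complex (u : nat -> R) (l : R) :
  u @ \oo --> l -> ((u n)%:C%C : C) @[n --> \oo] --> (l%:C%C : C).
Proof.
move=> /cvgrPdist_lt ul; apply/cvgrPdist_lt => /= e e0.
have eE : (complex.Re (e : R[i]))%:C%C = e :> R[i] by rewrite RRe_real // gtr0_real.
have : 0 < complex.Re (e : R[i]) by rewrite -ltcR eE.
move=> /ul; apply: filterS => n h.
by rewrite -rmorphB /= normc_def /= expr0n /= addr0 sqrtr_sqr -eE ltcR.
Qed.

(** Real and imaginary parts are bounded by the modulus, so each yields an absolutely convergent
    real series; the two real limits are then recombined. *)
Lemma complex_complete : abs_complete C.
Proof.
move=> u B uB.
have cvgR (v : nat -> R) : (forall k, `|v k|%:C%C <= `|u k| :> R[i]) ->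
    exists l : R, series v @ \oo --> l.
  move=> vu; have : cvgn [normed series v].
    apply: nondecreasing_is_cvgn.
      by apply: nondecreasing_series => n _ _ /=; apply: normr_ge0.
    exists (complex.Re (B : R[i])) => _ [n _ <-] /=.
    have : (\sum_(0 <= k < n) `|v k|)%:C%C <= B :> R[i].
      apply: le_trans (uB n); rewrite rmorph_sum; apply: ler_sum => k _; exact: vu.
    by rewrite lecE => /andP[].
  by move=> /normed_cvg/cvg_ex.
have [a ca] : exists l : R, series (fun k => complex.Re (u k : R[i])) @ \oo --> l.
  by apply: cvgR => k; apply: normc_ge_Re.
have [b cb] : exists l : R, series (fun k => complex.Im (u k : R[i])) @ \oo --> l.
  (* Up to sign the imaginary part of [u k] is the real part of its product with [i], which has the
     same modulus. *)
  apply: cvgR => k; rewrite -[X in `|X|]opprK -ReiNIm normrN.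
  apply: le_trans (normc_ge_Re _) _; rewrite normrM.
  by rewrite [X in _ * X]normc_def /= expr0n expr1n add0r sqrtr1 mulr1.
apply/cvg_ex; exists (a%:C%C + 'i%C * b%:C%C : C).
rewrite (_ : series u = (fun n => (series (fun k => complex.Re (u k : R[i])) n)%:C%C : C)
  \+ (fun n => ('i%C : C) * ((series (fun k => complex.Im (u k : R[i])) n)%:C%C : C))); last first.
  apply/funext => n /=; rewrite /series /= !rmorph_sum /= mulr_sumr -big_split /=.
  by apply: eq_bigr => k _; rewrite -complexE.
apply: cvgD; first exact: cvg_real_complex.
by apply: cvgM; [exact: cvg_cst | exact: cvg_real_complex].
Qed.

End ComplexComplete.

Section AbsComplete.
Variable K : numFieldType.
Implicit Types (c q r l B : K) (u v : nat -> K).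

Lemma norm_cvg_le u l B :
  u @ \oo --> l -> (forall n, `|u n| <= B) -> `|l| <= B.
Proof.
move=> /cvgrPdist_lt ul uB; have B0 : 0 <= B by apply: le_trans (uB 0%N).
rewrite real_leNgt ?normr_real ?ger0_real //; apply/negP => Bl.
have /ul[n _ /(_ n (leqnn n)) /= h] : 0 < `|l| - B by rewrite subr_gt0.
have le_l : `|l| <= `|l - u n| + `|u n| by rewrite -{1}(subrK (u n) l) ler_normD.
have : `|l| < `|l|; last by rewrite ltxx.
by apply: (le_lt_trans le_l); rewrite -ltrBrDr (lt_le_trans h) // lerB.
Qed.

Lemma norm_cvg_ge u l B : 0 <= B ->
  u @ \oo --> l -> (forall n, B <= `|u n|) -> B <= `|l|.
Proof.
move=> B0 /cvgrPdist_lt ul uB.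
rewrite real_leNgt ?normr_real ?ger0_real //; apply/negP => lB.
have /ul[n _ /(_ n (leqnn n)) /= h] : 0 < B - `|l| by rewrite subr_gt0.
have : B < B; last by rewrite ltxx.
have le_u : `|u n| <= `|u n - l| + `|l| by rewrite -{1}(subrK l (u n)) ler_normD.
by apply: (le_lt_trans (le_trans (uB n) le_u)); rewrite -ltrBrDr distrC.
Qed.

Lemma cvg_norm_bounded u : cvgn u -> exists B, forall n, `|u n| <= B.
Proof.
move=> /cvg_seq_bounded[M [Mr uM]]; exists (M + 1) => n.
by apply: uM => //; rewrite ltrDl.
Qed.

Lemma sum_expr_le r n : 0 <= r -> r < 1 ->
  \sum_(0 <= k < n) r ^+ k <= (1 - r)^-1.
Proof.
move=> r0 r1; have r1' : 0 < 1 - r by rewrite subr_gt0.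
rewrite big_mkord -[leRHS]mul1r ler_pdivlMr // mulrC -[1 - r]opprB mulNr -subrX1.
by rewrite opprB gerBl exprn_ge0.
Qed.

Lemma cvgMl0 c u : u @ \oo --> (0 : K) -> (c * u n) @[n --> \oo] --> (0 : K).
Proof. by move=> u0; rewrite -[X in _ --> X](mulr0 c); apply: cvgM u0; exact: cvg_cst. Qed.

Lemma cvgDr0 u v l : u @ \oo --> l -> v @ \oo --> (0 : K) ->
  (u n + v n) @[n --> \oo] --> l.
Proof. by move=> ul v0; rewrite -(addr0 l); apply: cvgD. Qed.

Lemma cvgD0 u v : u @ \oo --> (0 : K) -> v @ \oo --> (0 : K) ->
  (u n + v n) @[n --> \oo] --> (0 : K).
Proof. by move=> u0 v0; rewrite -[X in _ --> X](addr0 0); apply: cvgD. Qed.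

Hypothesis hK : abs_complete K.

Lemma series_geo_cvg u B r : 0 <= r -> r < 1 ->
  (forall n, `|u n| <= B * r ^+ n) -> cvgn (series u).
Proof.
move=> r0 r1 uB; have B0 : 0 <= B.
  by apply: le_trans (normr_ge0 (u 0%N)) _; rewrite (le_trans (uB 0%N)) // mulr1.
apply: (hK (B := B / (1 - r))) => n.
apply: (@le_trans _ _ (\sum_(0 <= k < n) B * r ^+ k)).
  by apply: ler_sum => k _; apply: uB.
by rewrite -mulr_sumr ler_wpM2l // sum_expr_le.
Qed.

Lemma series_geo_le u B r l : 0 <= r -> r < 1 ->
  (forall n, `|u n| <= B * r ^+ n) -> series u @ \oo --> l ->
  `|l| <= B / (1 - r).
Proof.
move=> r0 r1 uB ul; have B0 : 0 <= B.
  by apply: le_trans (normr_ge0 (u 0%N)) _; rewrite (le_trans (uB 0%N)) // mulr1.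
apply: (norm_cvg_le ul) => n; apply: le_trans (ler_norm_sum _ _ _) _.
apply: (@le_trans _ _ (\sum_(0 <= k < n) B * r ^+ k)).
  by apply: ler_sum => k _; apply: uB.
by rewrite -mulr_sumr ler_wpM2l // sum_expr_le.
Qed.

Lemma cvg_expr0 q : `|q| < 1 -> (q ^+ n) @[n --> \oo] --> (0 : K).
Proof.
move=> q1; apply: cvg_series_cvg_0.
apply: (@series_geo_cvg _ 1 `|q|) => // n.
by rewrite mul1r normrX.
Qed.

Lemma cvg0_le u v : (forall n, `|u n| <= `|v n|) ->
  v @ \oo --> (0 : K) -> u @ \oo --> (0 : K).
Proof.
move=> uv /cvgrPdist_lt v0; apply/cvgrPdist_lt => e /v0.
by apply: filterS => n; rewrite !sub0r !normrN; apply: le_lt_trans.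
Qed.

Lemma cvgM_bounded0 u v B : (forall n, `|u n| <= B) ->
  v @ \oo --> (0 : K) -> (u n * v n) @[n --> \oo] --> (0 : K).
Proof.
move=> uB v0; apply: (@cvg0_le _ (fun n => B * v n)).
  by move=> n; rewrite !normrM ler_wpM2r // (le_trans (uB n)) // real_ler_norm //
    ger0_real // (le_trans (normr_ge0 _) (uB 0%N)).
exact: cvgMl0.
Qed.

End AbsComplete.

Lemma sum_nat_addn (V : nmodType) (m n : nat) (F : nat -> V) :
  \sum_(m <= i < n) F i = \sum_(0 <= i < n - m) F (i + m)%N.
Proof. by rewrite -{1}[m]add0n big_addn. Qed.

(** * Power series with natural coefficients on the open unit disc *)

Section GeneratingFunctions.
Variable K : numFieldType.
Hypothesis hK : abs_complete K.
Implicit Types (q r : K) (u : nat -> K) (a b : nat -> nat) (F : K -> K).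

(** Analytic rather than formal, so that limits of generating functions can be taken pointwise in
    [q]. *)
Definition gf a F : Prop := forall q, `|q| < 1 ->
  \sum_(0 <= n < N) (a n)%:R * q ^+ n @[N --> \oo] --> F q.

Lemma eq_gf a b F G : (forall n, a n = b n) ->
  (forall q, `|q| < 1 -> F q = G q) -> gf a F -> gf b G.
Proof.
move=> ab FG aF q q1; rewrite -FG //; under eq_cvg do under eq_bigr do rewrite -ab.
exact: aF.
Qed.

(** At the norm of [q], again a point of the disc, all terms are nonnegative, so a partial sum is
    below every later one and hence below the limit. *)
Lemma gf_norm_sum_le a (L : nat) G q : gf a G -> `|q| < 1 ->
  \sum_(0 <= n < L) (a n)%:R * `|q| ^+ n <= `|G `|q| |.
Proof.
move=> aG q1; have t0 n : 0 <= (a n)%:R * `|q| ^+ n by rewrite mulr_ge0 ?exprn_ge0.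
have := aG `|q|; rewrite normr_id => /(_ q1); rewrite -(cvg_shiftn L) => h.
apply: (norm_cvg_ge _ h) => [|n]; first by apply: sumr_ge0.
rewrite [leRHS]ger0_norm ?sumr_ge0 //= [leRHS](big_cat_nat (n := L)) ?leq_addl //=.
by rewrite lerDl sumr_ge0.
Qed.

Lemma bounded_cvg_terms a q B : `|q| < 1 ->
  (forall N, \sum_(0 <= n < N) (a n)%:R * `|q| ^+ n <= B) ->
  ((a n)%:R * q ^+ n) @[n --> \oo] --> (0 : K).
Proof.
move=> q1 aB; apply: cvg_series_cvg_0; apply: (hK (B := B)) => N.
by under eq_bigr do rewrite normrM normrX normr_nat.
Qed.

Lemma gf_one : gf (fun n => n == 0%N) (fun _ => 1).
Proof.
move=> q _; rewrite -cvg_shiftS /=; under eq_cvg => N.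
  rewrite big_nat_recl //= mul1r big1 ?addr0; last by move=> i _; rewrite mul0r.
  over.
exact: cvg_cst.
Qed.

Lemma gf_sum (M : nat) (A : nat -> nat -> nat) (G : nat -> K -> K) :
  (forall i, (i < M)%N -> gf (A i) (G i)) ->
  gf (fun n => \sum_(0 <= i < M) A i n)%N (fun q => \sum_(0 <= i < M) G i q).
Proof.
elim: M => [|M IH] AG q q1.
  under eq_cvg => N.
    rewrite big1; last by move=> i _; rewrite big_geq ?mul0r.
    over.
  by rewrite big_geq //; exact: cvg_cst.
under eq_cvg => N.
  under eq_bigr do rewrite big_nat_recr //= natrD mulrDl.
  rewrite big_split /=; over.
rewrite big_nat_recr //=; apply: cvgD; last exact: AG.
by apply: IH => // i iM; apply: AG; rewrite ltnW.
Qed.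

Lemma gf_shift (s : nat) a F : gf a F ->
  gf (fun n => if (n < s)%N then 0%N else a (n - s)%N) (fun q => q ^+ s * F q).
Proof.
move=> aF q q1; rewrite -(cvg_shiftn s).
rewrite [X in X x @[x --> _]](_ : _ = fun N =>
  q ^+ s * \sum_(0 <= n < N) (a n)%:R * q ^+ n).
  by apply: cvgM; [exact: cvg_cst | exact: aF].
apply/funext => N /=; rewrite (big_cat_nat (n := s)) ?leq_addl //= big_nat big1 ?add0r.
  rewrite sum_nat_addn addnK mulr_sumr; apply: eq_bigr => i _.
  by rewrite ltnNge leq_addl /= addnK exprD mulrA mulrC.
by move=> i /andP[_ ->]; rewrite mul0r.
Qed.

(** The recursion says that [1 - q ^+ k] times the series of [b] is the series of [a]. For partial
    sums ([shiftE]) this leaves the last terms of the series of [b] as an error, which must be shown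
    to vanish. *)
Lemma gf_geom (k : nat) a b F : (0 < k)%N ->
  (forall n, b n = a n + if (n < k)%N then 0%N else b (n - k)%N)%N ->
  gf a F -> gf b (fun q => F q / (1 - q ^+ k)).
Proof.
move=> k0 bE aF.
have shiftE q N : (1 - q ^+ k) * \sum_(0 <= n < N) (b n)%:R * q ^+ n
    = \sum_(0 <= n < N) (a n)%:R * q ^+ n
      - q ^+ k * \sum_(N - k <= n < N) (b n)%:R * q ^+ n.
  have -> : \sum_(0 <= n < N) (a n)%:R * q ^+ n =
     \sum_(0 <= n < N) (b n)%:R * q ^+ n - \sum_(0 <= n < N)
       (if (n < k)%N then 0%N else b (n - k)%N)%:R * q ^+ n.
    by rewrite -sumrB; apply: eq_bigr => n _; rewrite -mulrBl bE natrD addrK.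
  rewrite mulrBl mul1r -addrA -opprD; congr (_ - _).
  rewrite [in LHS](big_cat_nat (n := (N - k)%N)) ?leq_subr //= mulrDr; congr (_ + _).
  have [kN|Nk] := leqP k N; last first.
    rewrite big_geq ?mulr0; last by rewrite (eqP (ltnW Nk)).
    rewrite big_nat big1 // => n /andP[_ nN].
    by rewrite (ltn_trans nN Nk) mul0r.
  rewrite [RHS](big_cat_nat (n := k)) //= (_ : \sum_(0 <= i < k) _ = 0) ?add0r; last first.
    by rewrite big_nat big1 // => i /andP[_ ->]; rewrite mul0r.
  rewrite (sum_nat_addn k) mulr_sumr; apply: eq_bigr => n _.
  by rewrite ltnNge leq_addl /= addnK exprD [RHS]mulrA [RHS]mulrC.
(* At the norm of [q] the error in [shiftE] is subtracted and nonnegative, so the partial sums of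
   [b] are bounded before their convergence is known. *)
have bounded q : `|q| < 1 -> exists B, forall N,
    \sum_(0 <= n < N) (b n)%:R * `|q| ^+ n <= B.
  move=> q1; exists (`|F `|q| | / (1 - `|q| ^+ k)) => N.
  have d0 : 0 < 1 - `|q| ^+ k by rewrite subr_gt0 exprn_ilt1 // -lt0n.
  rewrite ler_pdivlMr // mulrC shiftE.
  apply: le_trans (gf_norm_sum_le N aF q1); rewrite gerBl mulr_ge0 ?exprn_ge0 //.
  by apply: sumr_ge0 => n _; rewrite mulr_ge0 ?exprn_ge0.
move=> q q1; have [B bB] := bounded _ q1.
have d0 : 1 - q ^+ k != 0.
  rewrite subr_eq0; apply/eqP => qk; have : `|q ^+ k| < 1.
    by rewrite normrX exprn_ilt1 // -lt0n.
  by rewrite -qk normr1 ltxx.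
rewrite [X in X x @[x --> _]](_ : _ = fun N => (\sum_(0 <= n < N) (a n)%:R * q ^+ n
      - q ^+ k * \sum_(N - k <= n < N) (b n)%:R * q ^+ n) / (1 - q ^+ k)); last first.
  by apply/funext => N; rewrite -shiftE mulrC mulKf.
apply: cvgM; last exact: cvg_cst.
rewrite -[F q]subr0; apply: cvgB; first exact: aF.
apply: cvgMl0.
have t0 := bounded_cvg_terms q1 bB.
rewrite -(cvg_shiftn k) /=.
rewrite [X in X x @[x --> _]](_ : _ = fun N =>
  \sum_(0 <= i < k) (b (i + N)%N)%:R * q ^+ (i + N)); last first.
  by apply/funext => N; rewrite addnK (sum_nat_addn N) addKn.
(* The error now has exactly [k] terms, each tending to 0; their number is generalized to [m] for
   the induction. *)
suff h m : \sum_(0 <= i < m) (b (i + N)%N)%:R * q ^+ (i + N) @[N --> \oo] --> (0 : K).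
  exact: h.
elim: m => [|m IH].
  by under eq_cvg do rewrite big_geq //; exact: cvg_cst.
under eq_cvg do rewrite big_nat_recr //=.
apply: cvgD0; first exact: IH.
by have := t0; rewrite -(cvg_shiftn m) /=; under eq_cvg do rewrite addnC.
Qed.

(* Monotone convergence: the coefficients [A M n] increase to [a n], and the tail
   of the series of [A M] is dominated by that of [a] at [`|q|]. *)
Lemma gf_limit (A : nat -> nat -> nat) (G : nat -> K -> K) a F :
  (forall M, gf (A M) (G M)) -> (forall M n, A M n <= a n)%N ->
  (forall M n, (n < M)%N -> A M n = a n) ->
  (forall q, `|q| < 1 -> G M q @[M --> \oo] --> F q) -> gf a F.
Proof.
move=> AG Aa Aeq GF q q1.
have r1 : `| `|q| | < 1 by rewrite normr_id.
have [B GB] := cvg_norm_bounded (cvgP _ (GF _ r1)).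
have : cvgn (series (fun n => (a n)%:R * `|q| ^+ n)).
  (* The first [L] coefficients of [A L] are already those of [a], so the bounded values of [G]
     bound the partial sums of [a]. *)
  apply: (hK (B := B)) => L; apply: le_trans (GB L).
  apply: le_trans (gf_norm_sum_le L (AG L) q1); rewrite big_nat [leRHS]big_nat.
  apply: ler_sum => n /andP[_ nL].
  by rewrite normrM normrX normr_id normr_nat Aeq.
move=> /cvg_cauchy/cauchy_seriesP ca.
rewrite -[F q]add0r [X in X x @[x --> _]](_ : _ = (fun N =>
  (\sum_(0 <= n < N) (a n)%:R * q ^+ n - G N q) + G N q)); last first.
  by apply/funext => N; rewrite subrK.
apply: cvgD; last exact: GF.
apply/cvgrPdist_le => e e0; have [[P Q] /= [[m _ Pm] [m' _ Qm']] PQ] := ca _ e0.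
exists (maxn m m') => // N /=; rewrite geq_max => /andP[mN m'N].
rewrite sub0r opprB.
have := AG N _ q1; rewrite -(cvg_shiftn N) => /= h.
have {}h : (\sum_(0 <= k < n + N) (A N k)%:R * q ^+ k -
    \sum_(0 <= n < N) (a n)%:R * q ^+ n) @[n --> \oo] -->
    (G N q - \sum_(0 <= n < N) (a n)%:R * q ^+ n).
  by apply: cvgB => //; exact: cvg_cst.
apply: (norm_cvg_le h) => n; rewrite (big_cat_nat (n := N)) ?leq_addl //=.
rewrite [X in X + _ - _](_ : _ = \sum_(0 <= n < N) (a n)%:R * q ^+ n); last first.
  by apply: eq_big_nat => i /andP[_ iN]; rewrite Aeq.
rewrite addrC addKr; apply: le_trans (ler_norm_sum _ _ _) _.
apply: (@le_trans _ _ (\sum_(N <= k < n + N) (a k)%:R * `|q| ^+ k)).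
  by apply: ler_sum => k _; rewrite normrM normrX normr_nat ler_wpM2r ?exprn_ge0 // ler_nat.
have /= := PQ (N, n + N)%N; rewrite ger0_norm; last first.
  by apply: sumr_ge0 => k _; rewrite mulr_ge0 ?exprn_ge0.
move=> h'; apply/ltW/h'; split => /=; [exact: Pm | apply: Qm'].
exact: leq_trans m'N (leq_addl _ _).
Qed.

End GeneratingFunctions.

(** * q-products and Rogers-Fine recurrences *)

Section QProducts.
Variable K : numFieldType.
Hypothesis hK : abs_complete K.
Implicit Types (a p q r s y z : K).

(** The body of [qpoch] over a general [K]; over [R[i]] this makes [nu q] and [nu_sum q q]
    convertible. *)
Definition qprod a p (n : nat) : K := \prod_(0 <= j < n) (1 - a * p ^+ j).

Lemma qprod0 a p : qprod a p 0 = 1.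
Proof. by rewrite /qprod big_geq. Qed.

Lemma qprodS a p n : qprod a p n.+1 = qprod a p n * (1 - a * p ^+ n).
Proof. by rewrite /qprod big_nat_recr. Qed.

Lemma qprodSl a p n : qprod a p n.+1 = (1 - a) * qprod (a * p) p n.
Proof.
rewrite /qprod big_nat_recl // expr0 mulr1; congr (_ * _).
by apply: eq_bigr => i _; rewrite exprS mulrA.
Qed.

Lemma qprod0l p n : qprod 0 p n = 1.
Proof. by rewrite /qprod big1 // => i _; rewrite mul0r subr0. Qed.

Lemma qprodD a p m n : qprod a p (m + n) = qprod a p m * qprod (a * p ^+ m) p n.
Proof.
elim: n => [|n IH]; first by rewrite addn0 qprod0 mulr1.
by rewrite addnS !qprodS IH -mulrA -[X in _ = _ * (_ * (1 - X))]mulrA exprD.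
Qed.

(* Weierstrass: a tail of the product is at least [1 - \sum_j r ^+ (J.+1 + j)],
   which is at least [1/2] once [J] is large. *)
Lemma qprod_lower_bound r : 0 <= r -> r < 1 ->
  exists2 c, 0 < c & forall n, c <= qprod r r n.
Proof.
move=> r0 r1; have r1' : 0 < 1 - r by rewrite subr_gt0.
have fac j : 0 < 1 - r * r ^+ j <= 1.
  by rewrite -exprS subr_gt0 exprn_ilt1 //= gerBl exprn_ge0.
have pos n : 0 < qprod r r n by apply: prodr_gt0 => j _; case/andP: (fac j).
have [J Jle] : exists J, r ^+ J.+1 / (1 - r) <= 2^-1.
  have /cvgrPdist_lt /(_ ((1 - r) / 2)) : (r ^+ n) @[n --> \oo] --> (0 : K).
    by apply: cvg_expr0 => //; rewrite ger0_norm.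
  case=> [|J _ /(_ J.+1) /=]; first by rewrite divr_gt0.
  rewrite sub0r normrN normrX ger0_norm // => /(_ (leqnSn J)) /ltW h.
  by exists J; rewrite ler_pdivrMr // mulrC.
have tail n : qprod r r J * (1 - \sum_(0 <= j < n) r ^+ (J.+1 + j)) <= qprod r r (J + n).
  elim: n => [|n IH]; first by rewrite big_geq // subr0 mulr1 addn0.
  rewrite addnS qprodS big_nat_recr //= -exprS -addSn.
  have t0 : 0 <= r ^+ (J.+1 + n) by apply: exprn_ge0.
  have h : qprod r r (J + n) <= qprod r r J.
    rewrite qprodD; apply: ler_piMr; first exact/ltW/pos.
    apply: Num.Theory.prodr_ile1 => j _.
    by rewrite -mulrA -exprD; case/andP: (fac (J + j)%N) => /ltW -> ->.
  rewrite opprD addrA mulrDr [leRHS]mulrBr mulr1; apply: lerD => //.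
  by rewrite mulrN lerN2 ler_wpM2r.
exists (qprod r r J / 2) => [|n]; first by rewrite divr_gt0.
(* Removing factors only enlarges the product, so the bound for [J + n] factors also serves for
   [n]. *)
have mono : qprod r r (J + n) <= qprod r r n.
  rewrite addnC qprodD; apply: ler_piMr; first exact/ltW/pos.
  apply: Num.Theory.prodr_ile1 => j _.
  by rewrite -mulrA -exprD; case/andP: (fac (n + j)%N) => /ltW -> ->.
apply: le_trans mono; apply: le_trans (tail n).
apply: ler_wpM2l; first exact/ltW/pos.
rewrite lerBrDr -lerBrDl (_ : 1 - 2^-1 = 2^-1) ?[X in X - _](splitr 1) ?mul1r ?addrK //.
apply: le_trans Jle; under eq_bigr do rewrite exprD.
by rewrite -mulr_sumr ler_wpM2l ?exprn_ge0 // sum_expr_le.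
Qed.

(** Each factor has norm between [1 - x] and [1 + x] with [x = r * r ^+ j]. As
    [(1 + x) * (1 - x) <= 1], the lower bound [c] for the product also gives the upper bound [c^-1],
    uniformly in [a], [p] and [n]. *)
Lemma qprod_bounds r : 0 <= r -> r < 1 ->
  exists2 B, 0 < B & forall a p n, `|a| <= r -> `|p| <= r ->
   [/\ qprod a p n != 0, `|qprod a p n| <= B & `|(qprod a p n)^-1| <= B].
Proof.
move=> r0 r1; have [c c0 hc] := qprod_lower_bound r0 r1.
exists c^-1 => [|a p n ar pr]; first by rewrite invr_gt0.
have apr j : `|a * p ^+ j| <= r * r ^+ j.
  by rewrite normrM normrX ler_pM ?exprn_ge0 // lerXn2r ?nnegrE.
have fac j : 0 < 1 - r * r ^+ j by rewrite -exprS subr_gt0 exprn_ilt1.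
have low : c <= `|qprod a p n|.
  apply: le_trans (hc n) _; rewrite normr_prod; apply: ler_prod => j _.
  rewrite ltW //=; apply: le_trans (lerB_dist _ _); rewrite normr1.
  by rewrite lerB.
have up : `|qprod a p n| * qprod r r n <= 1.
  rewrite normr_prod -big_split /=; apply: Num.Theory.prodr_ile1 => j _.
  rewrite mulr_ge0 ?(ltW (fac _)) //=.
  apply: (@le_trans _ _ ((1 + r * r ^+ j) * (1 - r * r ^+ j))).
    rewrite ler_wpM2r ?(ltW (fac _)) //; apply: le_trans (ler_normB _ _) _.
    by rewrite normr1 lerD2l.
  by rewrite mulrC -subr_sqr expr1n gerBl exprn_ge0 // mulr_ge0 // exprn_ge0.
have low0 : 0 < `|qprod a p n| by apply: lt_le_trans low.
split; first by rewrite -normr_gt0.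
  have q0 : 0 < qprod r r n by apply: lt_le_trans (hc n).
  rewrite -(ler_pM2r q0); apply: le_trans up _.
  by rewrite -ler_pdivrMl ?invr_gt0 // invrK mulr1.
by rewrite normfV lef_pV2.
Qed.

End QProducts.

(** * The two-variable series nu(q; y) and its recurrence in y *)

Section NuSeries.
Variable K : numFieldType.
Hypothesis hK : abs_complete K.
Variable q : K.
Hypothesis q1 : `|q| < 1.
Implicit Types (y : K).

Let q2_le : `|q ^+ 2| <= `|q|.
Proof. by rewrite normrX; apply: ler_iXnr => //; exact: ltW. Qed.

Definition nu_term y n : K := q ^+ (n ^ 2 + n) / qprod (- y) (q ^+ 2) n.+1.

Definition nu_sum y : K := limn (series (nu_term y)).

Lemma nu_term_bound : exists2 B, 0 < B &
  forall y n, `|y| <= `|q| -> `|nu_term y n| <= B * `|q| ^+ n.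
Proof.
have [B B0 hB] := qprod_bounds hK (normr_ge0 q) q1.
exists B => // y n yq; rewrite normrM mulrC ler_pM //.
  by have [] := hB (- y) (q ^+ 2) n.+1 _ q2_le; rewrite ?normrN.
by rewrite normrX ler_wiXn2l ?(ltW q1) // leq_addl.
Qed.

Lemma nu_sum_cvg y : `|y| <= `|q| -> series (nu_term y) @ \oo --> nu_sum y.
Proof.
have [B B0 hB] := nu_term_bound => yq; rewrite /nu_sum.
have : cvgn (series (nu_term y)); last by [].
by apply: (series_geo_cvg hK (normr_ge0 q) q1 (B := B)) => n; apply: hB.
Qed.

(** Finite form of the recurrence: the difference of the two partial sums telescopes to an explicit
    remainder that tends to 0. *)
Lemma nu_series_rec y M : `|y| <= `|q| ->
  (1 - y ^+ 2) * series (nu_term y) M.+1 = series (nu_term (y * q ^+ 2)) M - y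
    + q ^+ (M ^ 2 + M) / qprod (- (y * q ^+ 2)) (q ^+ 2) M.
Proof.
move=> yq.
have [B _ hB] := qprod_bounds hK (normr_ge0 q) q1.
have n1 : 1 + y != 0.
  have [] := hB (- y) 0 1%N; rewrite ?normrN ?normr0 //.
  by rewrite qprodS qprod0 expr0 mul1r mulr1 opprK.
have yq2 : `|- (y * q ^+ 2)| <= `|q|.
  by rewrite normrN normrM -[leRHS]mulr1 ler_pM // (le_trans q2_le) // (ltW q1).
elim: M => [|M IH].
  rewrite /series /= big_nat1 big_geq // /nu_term qprodS !qprod0 expr0 !mul1r mulr1.
  by rewrite ?opprK; field.
rewrite seriesSr mulrDr IH seriesSr.
have [D0 _ _] := hB _ _ M yq2 q2_le.
have [D1 _ _] := hB _ _ M.+1 yq2 q2_le.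
rewrite [nu_term y M.+1]/nu_term [nu_term _ M]/nu_term (qprodSl (- y)) mulNr opprK.
move: D1; rewrite qprodS mulf_eq0 negb_or => /andP[_].
have -> : q ^+ (M.+1 ^ 2 + M.+1) = q ^+ (M ^ 2 + M) * ((q ^+ 2) ^+ M * q ^+ 2).
  by rewrite -exprM -!exprD; congr (_ ^+ _); lia.
(* With products and powers turned into variables, a rational identity remains. *)
move: (series _ _) (qprod _ _ _) (q ^+ (M ^ 2 + M)) ((q ^+ 2) ^+ M) D0 => S D P Z D0 D1.
field.
by rewrite D1 D0 n1.
Qed.

Lemma nu_sum_rec y : `|y| <= `|q| ->
  (1 - y ^+ 2) * nu_sum y = nu_sum (y * q ^+ 2) - y.
Proof.
move=> yq.
have [B _ hB] := qprod_bounds hK (normr_ge0 q) q1.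
have yq2 : `|y * q ^+ 2| <= `|q|.
  by rewrite normrM -[leRHS]mulr1 ler_pM // (le_trans q2_le) // (ltW q1).
have lhs : (1 - y ^+ 2) * series (nu_term y) M.+1 @[M --> \oo]
    --> (1 - y ^+ 2) * nu_sum y.
  apply: cvgM; first exact: cvg_cst.
  by have := nu_sum_cvg yq; rewrite -cvg_shiftS.
suff rhs : (1 - y ^+ 2) * series (nu_term y) M.+1 @[M --> \oo]
    --> nu_sum (y * q ^+ 2) - y by exact: (cvg_unique (@norm_hausdorff _ _) lhs rhs).
under eq_cvg do rewrite nu_series_rec //.
apply: cvgDr0.
  by apply: cvgB; [exact: nu_sum_cvg | exact: cvg_cst].
under eq_cvg do rewrite mulrC.
apply: (cvgM_bounded0 (B := B)) => [n|].
  by have [] := hB (- (y * q ^+ 2)) (q ^+ 2) n; rewrite ?normrN.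
apply: cvg0_le (cvg_expr0 hK q1) => n.
by rewrite !normrX ler_wiXn2l ?(ltW q1) // leq_addl.
Qed.

(** At [y = q ^+ (2 * k).+1] the multiplier [1 - y ^+ 2] is factor number [k] of the product, and
    the terms [- y] of the recurrences at [y] and [- y] cancel. *)
Lemma nu_sumN_iter k : qprod (q ^+ 2) (q ^+ 4) k * (nu_sum q + nu_sum (- q)) =
  nu_sum (q ^+ (2 * k).+1) + nu_sum (- q ^+ (2 * k).+1).
Proof.
elim: k => [|k IH]; first by rewrite qprod0 mul1r expr1.
have le_q : `|q ^+ (2 * k).+1| <= `|q|.
  by rewrite normrX; apply: ler_iXnr => //; exact: ltW.
have := nu_sum_rec le_q; have := nu_sum_rec (y := - q ^+ (2 * k).+1).
rewrite normrN sqrrN !mulNr opprK -exprD (_ : (2 * k).+1 + 2 = (2 * k.+1).+1)%N; last lia.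
move=> /(_ le_q) recN rec.
rewrite qprodS mulrAC IH mulrC -!exprM -exprD.
rewrite (_ : (2 + 4 * k = (2 * k).+1 * 2)%N); last lia.
by rewrite exprM mulrDr rec recN addrACA addNr addr0.
Qed.

(** Successive inverses differ by [- y * q ^+ (2 * n)] over the next product, so the total
    difference is bounded by a geometric series times the norm of [y]. *)
Lemma inv_qprod_sub1 : exists2 B, 0 < B & forall y n, `|y| <= `|q| ->
  `|(qprod (- y) (q ^+ 2) n)^-1 - 1| <= B * `|y|.
Proof.
have [B B0 hB] := qprod_bounds hK (normr_ge0 q) q1.
exists (B / (1 - `|q|)) => [|y n yq]; first by rewrite divr_gt0 // subr_gt0.
apply: (@le_trans _ _ (B * `|y| * \sum_(0 <= j < n) `|q| ^+ j)); last first.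
  by rewrite [leRHS]mulrAC ler_wpM2l ?mulr_ge0 ?(ltW B0) // sum_expr_le.
elim: n => [|n IH].
  by rewrite qprod0 invr1 subrr normr0 big_geq ?mulr0.
have yq' : `|- y| <= `|q| by rewrite normrN.
have [D0 _ _] := hB _ _ n yq' q2_le; have [E0 _ EB] := hB _ _ n.+1 yq' q2_le.
rewrite -(subrK (qprod (- y) (q ^+ 2) n)^-1 (_^-1)) -addrA.
apply: le_trans (ler_normD _ _) _; rewrite big_nat_recr //= mulrDr [leRHS]addrC.
apply: lerD => //.
rewrite (_ : _ - _ = - (y * (q ^+ 2) ^+ n * (qprod (- y) (q ^+ 2) n.+1)^-1)); last first.
  move: E0; rewrite qprodS mulf_eq0 negb_or => /andP[_ E0]; field.
  by rewrite E0 D0.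
rewrite normrN mulrC normrM -!mulrA ler_pM // normrM ler_pM //.
by rewrite normrX lerXn2r // nnegrE.
Qed.

(** This is continuity of [nu_sum] at base point 0; [near0] gives it in Lipschitz form, by comparing
    the two series term by term. *)
Lemma nu_sumN_cvg : (nu_sum (q ^+ (2 * k).+1) + nu_sum (- q ^+ (2 * k).+1)) @[k --> \oo]
  --> 2 * nu_sum 0.
Proof.
have [B B0 hB] := inv_qprod_sub1.
have near0 y : `|y| <= `|q| -> `|nu_sum y - nu_sum 0| <= B * `|y| / (1 - `|q|).
  move=> yq; have z0 : `|0 : K| <= `|q| by rewrite normr0.
  have h : series (fun n => nu_term y n - nu_term 0 n) @ \oo --> nu_sum y - nu_sum 0.
    rewrite (_ : series _ = (fun n => series (nu_term y) n - series (nu_term 0) n)).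
      by apply: cvgB; exact: nu_sum_cvg.
    by apply/funext => n; rewrite /series /= sumrB.
  apply: (series_geo_le (normr_ge0 q) q1 _ h) => n.
  rewrite /nu_term oppr0 qprod0l invr1 -mulrBr normrM mulrC ler_pM // ?hB //.
  by rewrite normrX ler_wiXn2l ?(ltW q1) // leq_addl.
rewrite mulr_natl mulr2n.
have lim0 (u : nat -> K) : (forall k, `|u k| = `|q ^+ (2 * k).+1|) ->
    nu_sum (u k) @[k --> \oo] --> nu_sum 0.
  move=> uE.
  rewrite -[nu_sum 0]add0r [X in X @ _](_ : _ = (fun k => nu_sum (u k) - nu_sum 0 + nu_sum 0)).
    apply: cvgD; last exact: cvg_cst.
    apply: (@cvg0_le _ _ (fun k => (B / (1 - `|q|)) * q ^+ k)) => [k|].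
      have u_le : `|u k| <= `|q|.
        by rewrite uE normrX; apply: ler_iXnr => //; exact: ltW.
      apply: le_trans (near0 _ u_le) _.
      rewrite mulrAC normrM [ `|B / _| ]ger0_norm ?divr_ge0 ?subr_ge0 ?(ltW B0) ?(ltW q1) //.
      rewrite ler_wpM2l ?divr_ge0 ?subr_ge0 ?(ltW B0) ?(ltW q1) // uE !normrX.
      by rewrite ler_wiXn2l ?(ltW q1) //; lia.
    exact/cvgMl0/cvg_expr0.
  by apply/funext => k; rewrite subrK.
by apply: cvgD; apply: lim0 => k //; rewrite normrN.
Qed.

End NuSeries.

(** * Rogers-Fine recurrences for the sums attached to EO2 and EO3 *)

Section RogersFine.
Variable K : numFieldType.
Hypothesis hK : abs_complete K.
Variable z : K.
Hypothesis z1 : `|z| < 1.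
Implicit Types (s : K).

Let z2_le : `|z ^+ 2| <= `|z|.
Proof. by rewrite normrX; apply: ler_iXnr => //; exact: ltW. Qed.

Let mulz2_le s : `|s| <= `|z| -> `|s * z ^+ 2| <= `|z|.
Proof.
by move=> sz; rewrite normrM -[leRHS]mulr1 ler_pM // (le_trans z2_le) // (ltW z1).
Qed.

Let mulz_le s : `|s| <= `|z| -> `|s * z| <= `|z|.
Proof. by move=> sz; rewrite normrM -[leRHS]mulr1 ler_pM // (ltW z1). Qed.

Let sub1_neq0 s : `|s| <= `|z| -> 1 - s != 0.
Proof.
move=> sz; rewrite subr_eq0; apply: contraTN z1 => /eqP s1.
by move: sz; rewrite -s1 normr1 => /le_gtF ->.
Qed.

Let expr_odd_le k : `|z ^+ (2 * k).+1| <= `|z|.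
Proof. by rewrite normrX; apply: ler_iXnr => //; exact: ltW. Qed.

Definition psi_term s n : K :=
  qprod s (z ^+ 2) n * s ^+ n / qprod (s * z) (z ^+ 2) n.

Definition omega_term s n : K := s ^+ n / qprod s (z ^+ 2) n.+1.

Lemma psi_term_bound : exists2 B, 0 < B &
  forall s n, `|s| <= `|z| -> `|psi_term s n| <= B * `|z| ^+ n.
Proof.
have [B B0 hB] := qprod_bounds hK (normr_ge0 z) z1.
exists (B * B) => [|s n sz]; first exact: mulr_gt0.
have [_ h1 _] := hB s (z ^+ 2) n sz z2_le.
have [_ _ h2] := hB _ (z ^+ 2) n (mulz_le sz) z2_le.
rewrite /psi_term mulrAC 2!normrM ler_pM ?mulr_ge0 // ?ler_pM //.
by rewrite normrX lerXn2r // nnegrE.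
Qed.

Lemma omega_term_bound : exists2 B, 0 < B &
  forall s n, `|s| <= `|z| -> `|omega_term s n| <= B * `|z| ^+ n.
Proof.
have [B B0 hB] := qprod_bounds hK (normr_ge0 z) z1.
exists B => // s n sz; have [_ _ h] := hB s (z ^+ 2) n.+1 sz z2_le.
rewrite /omega_term mulrC normrM ler_pM // normrX.
by rewrite lerXn2r // nnegrE.
Qed.

Definition psi_sum s : K := limn (series (psi_term s)).

Definition omega_sum s : K := limn (series (omega_term s)).

Lemma psi_sum_cvg s : `|s| <= `|z| -> series (psi_term s) @ \oo --> psi_sum s.
Proof.
have [B B0 hB] := psi_term_bound => sz; rewrite /psi_sum.
have : cvgn (series (psi_term s)); last by [].
by apply: (series_geo_cvg hK (normr_ge0 z) z1 (B := B)) => n; apply: hB.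
Qed.

Lemma omega_sum_cvg s : `|s| <= `|z| -> series (omega_term s) @ \oo --> omega_sum s.
Proof.
have [B B0 hB] := omega_term_bound => sz; rewrite /omega_sum.
have : cvgn (series (omega_term s)); last by [].
by apply: (series_geo_cvg hK (normr_ge0 z) z1 (B := B)) => n; apply: hB.
Qed.

(** Uniform in [s], so that the remainder after [k] iterations of the recurrence vanishes in the
    limit. *)
Lemma psi_sum_bounded : exists B, forall s, `|s| <= `|z| -> `|psi_sum s| <= B.
Proof.
have [B B0 hB] := psi_term_bound; exists (B / (1 - `|z|)) => s sz.
by apply: (series_geo_le (normr_ge0 z) z1 _ (psi_sum_cvg sz)) => n; apply: hB.
Qed.

Lemma omega_sum_bounded : exists B, forall s, `|s| <= `|z| -> `|omega_sum s| <= B.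
Proof.
have [B B0 hB] := omega_term_bound; exists (B / (1 - `|z|)) => s sz.
by apply: (series_geo_le (normr_ge0 z) z1 _ (omega_sum_cvg sz)) => n; apply: hB.
Qed.

(** The exact remainder is a power of [s] times a quotient of bounded products, so the limit is
    immediate. *)
Lemma psi_series_rec s M : `|s| <= `|z| ->
  series (psi_term s) M.+1 =
    1 + s + s ^+ 2 * z * series (psi_term (s * z ^+ 2)) M
    - s ^+ M.+1 * (qprod (s * z ^+ 2) (z ^+ 2) M / qprod (s * z) (z ^+ 2) M).
Proof.
move=> sz; have [B _ hB] := qprod_bounds hK (normr_ge0 z) z1.
elim: M => [|M IH].
  rewrite seriesSr /series /= !big_geq // /psi_term !qprod0 expr0 expr1.
  by field.
rewrite seriesSr IH seriesSr [psi_term s _]/psi_term [psi_term _ M]/psi_term.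
have [D0 _ _] := hB _ _ M (mulz_le sz) z2_le.
have [D1 _ _] := hB _ _ M.+1 (mulz_le sz) z2_le.
have [E0 _ _] := hB _ _ M (mulz2_le (mulz_le sz)) z2_le.
have sz0 := sub1_neq0 (mulz_le sz).
rewrite (qprodSl s) (qprodS (s * z ^+ 2)) exprMn (_ : s * z ^+ 2 * z = s * z * z ^+ 2); last ring.
have -> : qprod (s * z * z ^+ 2) (z ^+ 2) M = qprod (s * z) (z ^+ 2) M.+1 / (1 - s * z).
  by rewrite qprodSl [RHS]mulrC mulKf.
move: D1; rewrite qprodS mulf_eq0 negb_or => /andP[_].
rewrite (exprS s M.+1) (exprS s M).
move: (series _ _) (qprod (s * z) _ _) (qprod (s * z ^+ 2) _ _) (s ^+ M) ((z ^+ 2) ^+ M) D0.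
move=> S D A P Z D0 D1; field.
by rewrite D0 D1 sz0.
Qed.

(** The square of [1 - s], picked up at each step, is what builds the squared product in the
    denominator of omega. *)
Lemma omega_series_rec s M : `|s| <= `|z| ->
  series (omega_term s) M.+1 =
    (1 + s ^+ 2 * z ^+ 2 * series (omega_term (s * z ^+ 2)) M
    - s ^+ M.+1 * (qprod (s * z ^+ 2) (z ^+ 2) M)^-1) / (1 - s) ^+ 2.
Proof.
move=> sz; have [B _ hB] := qprod_bounds hK (normr_ge0 z) z1.
have s0 := sub1_neq0 sz.
elim: M => [|M IH].
  rewrite seriesSr /series /= !big_geq // /omega_term qprodS !qprod0 expr0 expr1.
  by field.
rewrite seriesSr IH seriesSr [omega_term s _]/omega_term [omega_term _ M]/omega_term.
have [D0 _ _] := hB _ _ M (mulz2_le sz) z2_le.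
have [D1 _ _] := hB _ _ M.+1 (mulz2_le sz) z2_le.
rewrite (qprodSl s) exprMn.
move: D1; rewrite qprodS mulf_eq0 negb_or => /andP[_].
rewrite (exprS s M.+1) (exprS s M).
move: (series _ _) (qprod (s * z ^+ 2) _ _) (s ^+ M) ((z ^+ 2) ^+ M) D0.
move=> S A P Z D0 D1; field.
by rewrite D0 D1 s0.
Qed.

Lemma psi_sum_rec s : `|s| <= `|z| ->
  psi_sum s = 1 + s + s ^+ 2 * z * psi_sum (s * z ^+ 2).
Proof.
move=> sz; have [B B0 hB] := qprod_bounds hK (normr_ge0 z) z1.
have lhs : series (psi_term s) M.+1 @[M --> \oo] --> psi_sum s.
  by have := psi_sum_cvg sz; rewrite -cvg_shiftS.
suff rhs : series (psi_term s) M.+1 @[M --> \oo] -->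
    1 + s + s ^+ 2 * z * psi_sum (s * z ^+ 2).
  exact: (cvg_unique (@norm_hausdorff _ _) lhs rhs).
under eq_cvg do rewrite psi_series_rec //.
apply: cvgDr0.
  apply: cvgD; first exact: cvg_cst.
  by apply: cvgM; [exact: cvg_cst | apply: psi_sum_cvg; exact: mulz2_le].
under eq_cvg do rewrite mulrC -mulNr.
apply: (cvgM_bounded0 (B := B * B)) => [n|].
  have [_ h1 _] := hB _ _ n (mulz2_le sz) z2_le.
  have [_ _ h2] := hB _ _ n (mulz_le sz) z2_le.
  by rewrite normrN normrM ler_pM.
apply: cvg0_le (cvg_expr0 hK z1) => n.
rewrite !normrX (@le_trans _ _ (`|z| ^+ n.+1)) ?lerXn2r // ?nnegrE //.
by rewrite ler_wiXn2l // (ltW z1).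
Qed.

Lemma omega_sum_rec s : `|s| <= `|z| ->
  omega_sum s = (1 + s ^+ 2 * z ^+ 2 * omega_sum (s * z ^+ 2)) / (1 - s) ^+ 2.
Proof.
move=> sz; have [B B0 hB] := qprod_bounds hK (normr_ge0 z) z1.
have lhs : series (omega_term s) M.+1 @[M --> \oo] --> omega_sum s.
  by have := omega_sum_cvg sz; rewrite -cvg_shiftS.
suff rhs : series (omega_term s) M.+1 @[M --> \oo] -->
    (1 + s ^+ 2 * z ^+ 2 * omega_sum (s * z ^+ 2)) / (1 - s) ^+ 2.
  exact: (cvg_unique (@norm_hausdorff _ _) lhs rhs).
under eq_cvg do rewrite omega_series_rec //.
apply: cvgM; last exact: cvg_cst.
apply: cvgDr0.
  apply: cvgD; first exact: cvg_cst.
  by apply: cvgM; [exact: cvg_cst | apply: omega_sum_cvg; exact: mulz2_le].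
under eq_cvg do rewrite mulrC -mulNr.
apply: (cvgM_bounded0 (B := B)) => [n|].
  have [_ _ h1] := hB _ _ n (mulz2_le sz) z2_le.
  by rewrite normrN.
apply: cvg0_le (cvg_expr0 hK z1) => n.
rewrite !normrX (@le_trans _ _ (`|z| ^+ n.+1)) ?lerXn2r // ?nnegrE //.
by rewrite ler_wiXn2l // (ltW z1).
Qed.

Lemma psi_sum_iter k : psi_sum z =
  \sum_(0 <= n < k) (z ^+ (n * (2 * n + 1)) + z ^+ (n.+1 * (2 * n + 1)))
  + z ^+ (k * (2 * k + 1)) * psi_sum (z ^+ (2 * k).+1).
Proof.
elim: k => [|k IH]; first by rewrite big_geq // add0r mul1r expr1.
rewrite big_nat_recr //= IH -addrA; congr (_ + _).
rewrite (psi_sum_rec (expr_odd_le k)) -exprM -exprD.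
rewrite (_ : ((2 * k).+1 + 2 = (2 * k.+1).+1)%N); last lia.
have -> : z ^+ (k.+1 * (2 * k + 1)) = z ^+ (k * (2 * k + 1)) * z ^+ (2 * k).+1.
  by rewrite -exprD; congr (_ ^+ _); lia.
have -> : z ^+ (k.+1 * (2 * k.+1 + 1)) =
    z ^+ (k * (2 * k + 1)) * (z ^+ ((2 * k).+1 * 2) * z).
  by rewrite -exprSr -exprD; congr (_ ^+ _); lia.
by ring.
Qed.

(** At [s = z ^+ (2 * k).+1] the factor [s ^+ 2 * z ^+ 2] raises the exponent by [4 * k + 4], the
    increment of [2 * k ^ 2 + 2 * k]. *)
Lemma omega_sum_iter k : omega_sum z =
  \sum_(0 <= n < k) z ^+ (2 * n ^ 2 + 2 * n) / qprod z (z ^+ 2) n.+1 ^+ 2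
  + z ^+ (2 * k ^ 2 + 2 * k) * ((qprod z (z ^+ 2) k)^-1 ^+ 2 * omega_sum (z ^+ (2 * k).+1)).
Proof.
have [B _ hB] := qprod_bounds hK (normr_ge0 z) z1.
elim: k => [|k IH].
  by rewrite big_geq // add0r !mul1r qprod0 invr1 expr1n mul1r expr1.
rewrite big_nat_recr //= IH -addrA; congr (_ + _).
rewrite (omega_sum_rec (expr_odd_le k)) -!exprM -!exprD.
rewrite (_ : ((2 * k).+1 + 2 = (2 * k.+1).+1)%N); last lia.
have [D0 _ _] := hB _ _ k (lexx _) z2_le.
have s0 := sub1_neq0 (expr_odd_le k).
rewrite qprodS -exprM -exprS.
have -> : z ^+ (2 * k.+1 ^ 2 + 2 * k.+1) = z ^+ (2 * k ^ 2 + 2 * k) * z ^+ ((2 * k).+1 * 2 + 2).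
  by rewrite -exprD; congr (_ ^+ _); lia.
move: (omega_sum _) (qprod _ _ _) (z ^+ (2 * k ^ 2 + _)) (z ^+ (_ * 2 + 2)) (z ^+ (2 * k).+1) D0 s0.
by move=> W D P Y Z D0 s0; field; rewrite D0 s0.
Qed.

Lemma psi_sum_pairs_cvg :
  (\sum_(0 <= n < k) (z ^+ (n * (2 * n + 1)) + z ^+ (n.+1 * (2 * n + 1))))
    @[k --> \oo] --> psi_sum z.
Proof.
have [B hB] := psi_sum_bounded.
rewrite [X in X @ _](_ : _ = (fun k => psi_sum z -
  psi_sum (z ^+ (2 * k).+1) * z ^+ (k * (2 * k + 1)))); last first.
  by apply/funext => k; rewrite [in RHS](psi_sum_iter k) [X in _ - X]mulrC addrK.
rewrite -[X in _ --> X]subr0; apply: cvgB; first exact: cvg_cst.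
apply: (cvgM_bounded0 (B := B)) => [k|]; first exact: hB.
apply: cvg0_le (cvg_expr0 hK z1) => n.
by rewrite !normrX ler_wiXn2l // ?(ltW z1) //; lia.
Qed.

Lemma omega_series_cvg :
  series (fun n => z ^+ (2 * n ^ 2 + 2 * n) / qprod z (z ^+ 2) n.+1 ^+ 2) @ \oo
    --> omega_sum z.
Proof.
have [B B0 hB] := qprod_bounds hK (normr_ge0 z) z1.
have [B' hB'] := omega_sum_bounded.
rewrite [X in X @ _](_ : _ = (fun k => omega_sum z -
  ((qprod z (z ^+ 2) k)^-1 ^+ 2 * omega_sum (z ^+ (2 * k).+1)) *
   z ^+ (2 * k ^ 2 + 2 * k))); last first.
  by apply/funext => k; rewrite [in RHS](omega_sum_iter k) [X in _ - X]mulrC addrK.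
rewrite -[X in _ --> X]subr0; apply: cvgB; first exact: cvg_cst.
apply: (cvgM_bounded0 (B := B ^+ 2 * B')) => [k|].
  have [_ _ h] := hB _ _ k (lexx _) z2_le.
  by rewrite normrM normrX ler_pM ?exprn_ge0 ?hB' // lerXn2r ?nnegrE ?(ltW B0).
apply: cvg0_le (cvg_expr0 hK z1) => n.
by rewrite !normrX ler_wiXn2l // ?(ltW z1) //; lia.
Qed.

End RogersFine.

(** * Counting partitions by multiplicities *)

Section Enumeration.
Local Open Scope nat_scope.
Implicit Types (e : nat -> option bool) (la s : seq nat).

(** Parity or absence: the two kinds of constraint that EO2 and EO3 put on a single part size. *)
Definition mult_ok (o : option bool) (k : nat) : bool :=
  if o is Some b then odd k == b else k == 0.

Definition arith_idx (k c n : nat) : seq nat := [seq i <- iota 0 n.+1 | i * k + c <= n].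
Arguments arith_idx : simpl never.

(** An explicit list, whose size obeys a recursion in [m]. The weight [i * (2 * m) + b * m] of the
    copies of [m] runs through an arithmetic progression in [i]. *)
Fixpoint part_enum e (m n : nat) : seq (seq nat) :=
  if m is m'.+1 then
    if e m is Some b then
      [seq nseq (2 * i + b) m ++ la | i <- arith_idx (2 * m) (b * m) n,
        la <- part_enum e m' (n - (i * (2 * m) + b * m))]
    else part_enum e m' n
  else if n == 0 then [:: [::]] else [::].

Lemma geq_sorted_catE (a : nat) la : sorted geq la -> (forall x, x \in la -> x <= a) ->
  la = nseq (count_mem a la) a ++ [seq x <- la | x != a].
Proof.
elim: la => //= x s IH ps le_a.
have sle y : y \in s -> y <= x.
  by move: ps; rewrite (path_sortedE (rev_trans leq_trans)) => /andP[/allP h _] /h.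
have [xa|xa] := eqVneq x a.
  by rewrite add1n /= xa -IH ?(path_sorted ps) // => y ys; rewrite le_a // inE ys orbT.
have {xa} xa : x < a by rewrite ltn_neqAle xa le_a ?mem_head.
rewrite add0n (_ : count_mem a s = 0) /=.
  congr (_ :: _); apply/esym/all_filterP/allP => y ys.
  by rewrite neq_ltn (leq_ltn_trans (sle _ ys) xa).
by apply/count_memPn/negP => /sle; rewrite leqNgt xa.
Qed.

Lemma sorted_nseq_cat (k a : nat) la : sorted geq la -> (forall x, x \in la -> x <= a) ->
  sorted geq (nseq k a ++ la).
Proof.
move=> sl le_a; elim: k => //= k IH; rewrite (path_sortedE (rev_trans leq_trans)) IH andbT.
by apply/allP => x; rewrite mem_cat mem_nseq => /orP[/andP[_ /eqP ->]|/le_a].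
Qed.

Lemma mem_part_enum e m n la : la \in part_enum e m n <->
  [/\ is_part la, sumn la = n, forall a, a \in la -> a <= m &
   forall j, 0 < j <= m -> mult_ok (e j) (count_mem j la)].
Proof.
elim: m n la => [|m IH] n la.
  rewrite /=; case: n => [|n]; rewrite ?inE; split => //=.
  - by move=> /eqP ->; split => // -[|j].
  - case=> -[_ pos] _ le0 _; case: la pos le0 => // a la pos le0.
    by have := pos a (mem_head _ _); rewrite ltnNge le0 ?mem_head.
  case=> -[_ pos] sn le0 _; case: la pos le0 sn => // a la pos le0.
  by have := pos a (mem_head _ _); rewrite ltnNge le0 ?mem_head.
have step k la' : (forall a, a \in la' -> a <= m) ->
    (forall j, j <= m -> count_mem j (nseq k m.+1 ++ la') = count_mem j la') /\
    count_mem m.+1 (nseq k m.+1 ++ la') = k.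
  move=> lem; split=> [j jm|].
    by rewrite count_cat count_nseq /= (gtn_eqF (n := m.+1)) ?ltnS.
  rewrite count_cat count_nseq /= eqxx mul1n (_ : count_mem _ la' = 0) ?addn0 //.
  by apply/count_memPn/negP => /lem; rewrite ltnn.
have catP k la' n' : is_part la' -> sumn la' = n' -> (forall a, a \in la' -> a <= m) ->
    [/\ is_part (nseq k m.+1 ++ la'), sumn (nseq k m.+1 ++ la') = k * m.+1 + n' &
     forall a, a \in nseq k m.+1 ++ la' -> a <= m.+1].
  move=> [sl pos] sn lem; split; first split.
  - by apply: sorted_nseq_cat => // x /lem /leqW.
  - by move=> a; rewrite mem_cat mem_nseq => /orP[/andP[_ /eqP ->]|/pos].
  - by rewrite sumn_cat sumn_nseq sn mulnC.
  - by move=> a; rewrite mem_cat mem_nseq => /orP[/andP[_ /eqP ->]|/lem /leqW].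
rewrite /=; case em : (e m.+1) => [b|]; last first.
  rewrite IH; split => -[pl sn lem ok]; split => //.
  - by move=> a /lem /leqW.
  - move=> j /andP[j0]; rewrite leq_eqVlt => /orP[/eqP ->|jm]; last by apply: ok; rewrite j0.
    by rewrite em /=; apply/eqP/count_memPn/negP => /lem; rewrite ltnn.
  - move=> a al; have := lem _ al; rewrite leq_eqVlt => /orP[/eqP am|//].
    by have := ok m.+1 (leqnn _); rewrite em -am /= => /eqP/count_memPn; rewrite al.
  by move=> j /andP[j0 jm]; apply: ok; rewrite j0 leqW.
split.
  case/allpairsPdep => i [la' [+ + ->]]; rewrite mem_filter => /andP[le_n _].
  move=> /IH[pl sn lem ok]; have [cl c0] := step (2 * i + b) _ lem.
  have [h1 h2 h3] := catP (2 * i + b) _ _ pl sn lem; split => //.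
    by rewrite h2 -[RHS](subnKC le_n); congr (_ + _); lia.
  move=> j /andP[j0]; rewrite leq_eqVlt => /orP[/eqP ->|jm].
    by rewrite c0 em /= oddD mul2n odd_double; case: (b).
  by rewrite cl //; apply: ok; rewrite j0.
case=> -[sl pos] sn lem ok.
(* Conversely, the copies of [m.+1] come first in the sorted list, and the rest falls under the
   induction hypothesis. *)
have laE := geq_sorted_catE sl lem.
set k := count_mem m.+1 la in laE; set la' := [seq x <- la | _] in laE.
have kb : odd k = b by have := ok m.+1 (leqnn _); rewrite em => /eqP.
have kE : k = 2 * k./2 + b by rewrite -[LHS]odd_double_half kb addnC mul2n.
have lem' a : a \in la' -> a <= m.
  by rewrite mem_filter => /andP[am /lem]; rewrite leq_eqVlt (negbTE am).
have snE : n = k * m.+1 + sumn la' by rewrite -sn {1}laE sumn_cat sumn_nseq mulnC.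
apply/allpairsPdep; exists k./2, la'; split.
- rewrite mem_filter mem_iota add0n /=.
  have : k * m.+1 <= n by rewrite snE leq_addr.
  by rewrite {1}kE => h; apply/andP; split; nia.
- apply/IH; split => //.
  + split; first exact: (sorted_filter (rev_trans leq_trans)).
    by move=> a; rewrite mem_filter => /andP[_ /pos].
  + by rewrite snE {1}kE; nia.
  move=> j /andP[j0 jm]; have [cl _] := step k _ lem'.
  by rewrite -cl // -laE; apply: ok; rewrite j0 leqW.
by rewrite -kE.
Qed.

(** The multiplicity of [m.+1] recovers the index [i]; then the common prefix cancels. *)
Lemma part_enum_uniq e m n : uniq (part_enum e m n).
Proof.
elim: m n => [|m IH] n /=; first by case: ifP.
case: (e m.+1) => [b|] //; apply: allpairs_uniq_dep => //.
  by rewrite /arith_idx filter_uniq // iota_uniq.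
move=> _ _ /allpairsPdep[i [la [_ + ->]]] /allpairsPdep[i' [la' [_ + ->]]] /=.
move=> /mem_part_enum[_ _ lem _] /mem_part_enum[_ _ lem' _] E.
have cnt k s : (forall a, a \in s -> a <= m) -> count_mem m.+1 (nseq k m.+1 ++ s) = k.
  move=> h; rewrite count_cat count_nseq /= eqxx mul1n (_ : count_mem _ s = 0) ?addn0 //.
  by apply/count_memPn/negP => /h; rewrite ltnn.
have ii' : i = i'.
  by have := congr1 (count_mem m.+1) E; rewrite !cnt // => /addIn /eqP; rewrite eqn_pmul2l // => /eqP.
by move: E; rewrite ii' => /eqP; rewrite eqseq_cat // => /andP[_ /eqP ->].
Qed.

End Enumeration.

(** * Finite products as generating functions of the enumerations *)

Section EnumerationGF.
Variable K : numFieldType.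
Hypothesis hK : abs_complete K.
Implicit Types (a : nat -> nat) (F : K -> K) (q : K) (e : nat -> option bool).

(** Splitting off the index [i = 0] leaves the same sum at [n - k], which is the recursion of
    [gf_geom]. *)
Lemma gf_arith (k c : nat) a F : (0 < k)%N -> gf a F ->
  gf (fun n => \sum_(i <- arith_idx k c n) a (n - (i * k + c)))%N
     (fun q => q ^+ c * F q / (1 - q ^+ k)).
Proof.
move=> k0 aF; apply: (gf_geom hK k0 _ (gf_shift (s := c) aF)) => n.
have idxE m f : (\sum_(i <- arith_idx k c m) f i =
    \sum_(0 <= i < m.+1 | i * k + c <= m) f i)%N by rewrite big_filter.
rewrite !idxE big_mkcond big_nat_recl //= mul0n add0n -big_mkcond /=; congr (_ + _)%N.
  by rewrite leqNgt; case: ltnP.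
have [nk|kn] := ltnP n k.
  by rewrite big1 // => i; lia.
rewrite (big_cat_nat (n := (n - k).+1)) //=; last lia.
rewrite [X in (_ + X)%N]big_nat_cond [X in (_ + X)%N]big1 ?addn0; last by move=> i; nia.
apply: eq_big => [i|i _]; first by rewrite mulSn; lia.
by congr (a _); rewrite mulSn; lia.
Qed.

(** The sum of [q ^+ (j * k)] over the multiplicities [k] that the constraint allows. *)
Definition mult_factor q (j : nat) (o : option bool) : K :=
  if o is Some b then q ^+ (b * j) / (1 - q ^+ (2 * j)) else 1.

Lemma gf_part_enum e m : gf (fun n => size (part_enum e m n))
  (fun q => \prod_(0 <= j < m) mult_factor q j.+1 (e j.+1)).
Proof.
elim: m => [|m IH].
  apply: eq_gf (@gf_one K) => [n|q _]; first by case: n.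
  by rewrite big_geq.
case em : (e m.+1) => [b|]; last first.
  apply: eq_gf IH => [n|q _]; first by rewrite /= em.
  by rewrite big_nat_recr //= em mulr1.
apply: eq_gf (gf_arith (c := b * m.+1) (k := 2 * m.+1) _ IH) => [n|q _|]; last by [].
  by rewrite /= em size_allpairs_dep sumnE big_map.
by rewrite [RHS]big_nat_recr //= em /= mulrA [X in X / _]mulrC.
Qed.

End EnumerationGF.

(** * Counting a set of partitions that is a disjoint union of multiplicity profiles *)

Section Counting.
Variable C : set (seq nat).
Variable e : nat -> nat -> option bool.
Hypothesis C_mult : forall la, is_part la -> C la <->
  exists i, forall j, (0 < j)%N -> mult_ok (e i j) (count_mem j la).
Hypothesis e_odd : forall i j, (0 < j)%N -> (e i j == Some true) = (j == (2 * i).+1).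
Hypothesis e_lt : forall i i', (i < i')%N ->
  e i' (2 * i).+1 = None \/ e i (2 * i').+1 = None.

(** Each profile forces its own size [2 * i + 1] to occur, and for two distinct indices one of these
    sizes is forbidden by the other profile. *)
Lemma mult_profile_inj la i i' :
  (forall j, (0 < j)%N -> mult_ok (e i j) (count_mem j la)) ->
  (forall j, (0 < j)%N -> mult_ok (e i' j) (count_mem j la)) -> i = i'.
Proof.
wlog ii' : i i' / (i < i')%N => [H h h'|h h'].
  by case: (ltngtP i i') => // ii'; [apply: H | apply/esym/H].
have od k : e k (2 * k).+1 = Some true by apply/eqP; rewrite e_odd.
case: (e_lt ii') => E.
  have := h' (2 * i).+1 isT; rewrite E => /eqP c0.
  by have := h (2 * i).+1 isT; rewrite od c0.
have := h (2 * i').+1 isT; rewrite E => /eqP c0.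
by have := h' (2 * i').+1 isT; rewrite od c0.
Qed.

(** The truncation always lists a subset, and for [n < M] the whole set: the two inputs of
    [gf_limit]. *)
Let enum (M n : nat) : seq (seq nat) :=
  [seq la | i <- iota 0 M, la <- part_enum (e i) (2 * M) n].

Let ok_gt i j : (0 < j)%N -> j != (2 * i).+1 -> mult_ok (e i j) 0.
Proof. by move=> j0; rewrite -e_odd //; case: (e i j) => [[]|]. Qed.

(** Sizes above [2 * M] do not occur, and multiplicity 0 is allowed there because the only odd
    requirement sits at [2 * i + 1], below [2 * M]. *)
Let mem_enum i M n la : (i < M)%N -> la \in part_enum (e i) (2 * M) n <->
  [/\ is_part la, sumn la = n, forall a, a \in la -> (a <= 2 * M)%N &
   forall j, (0 < j)%N -> mult_ok (e i j) (count_mem j la)].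
Proof.
move=> iM; split => [/mem_part_enum[pl sn lem ok]|[pl sn lem ok]]; last first.
  by apply/mem_part_enum; split => // j /andP[j0 _]; apply: ok.
split => // j j0; have [jM|Mj] := leqP j (2 * M); first by apply: ok; rewrite j0.
have -> : count_mem j la = 0%N.
  by apply/count_memPn/negP => /lem; rewrite leqNgt Mj.
by apply: ok_gt => //; lia.
Qed.

Let enum_uniq M n : uniq (enum M n).
Proof.
apply: allpairs_uniq_dep => [|i _|]; first exact: iota_uniq.
  exact: part_enum_uniq.
move=> _ _ /allpairsPdep[i [la [+ + ->]]] /allpairsPdep[i' [la' [+ + ->]]] /= ll'.
rewrite !mem_iota !add0n -{}ll' /= => iM /(mem_enum _ _ iM)[_ _ _ ok].
move=> i'M /(mem_enum _ _ i'M)[_ _ _ ok'].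
by rewrite (mult_profile_inj ok ok').
Qed.

Let enum_sub M n la : la \in enum M n -> [/\ is_part la, sumn la = n & C la].
Proof.
case/allpairsPdep => i [la' [+ + ->]]; rewrite mem_iota add0n /= => iM.
move=> /(mem_enum _ _ iM)[pl sn _ ok]; split => //.
by apply/C_mult => //; exists i.
Qed.

Let sub_enum M n la : (n < M)%N -> [/\ is_part la, sumn la = n & C la] -> la \in enum M n.
Proof.
move=> nM [pl sn /(C_mult pl)[i ok]].
have le_n a : a \in la -> (a <= n)%N.
  by rewrite -sn => /perm_to_rem/perm_sumn -> /=; rewrite leq_addr.
have iM : (i < M)%N.
  have := ok (2 * i).+1 isT; have /eqP -> : e i (2 * i).+1 == Some true by rewrite e_odd.
  move=> o; have /le_n h : (2 * i).+1 \in la; last lia.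
  by apply: contraTT o => /count_memPn c0; rewrite c0.
apply/allpairsPdep; exists i, la; split; rewrite ?mem_iota //.
apply/(mem_enum _ _ iM); split => // a /le_n h; lia.
Qed.

Let size_enum M n :
  size (enum M n) = (\sum_(0 <= i < M) size (part_enum (e i) (2 * M) n))%N.
Proof. by rewrite size_allpairs_dep sumnE big_map /index_iota subn0. Qed.

Let size_fset_enum M n : #|` [fset la in enum M n]%fset| = size (enum M n).
Proof. by rewrite card_fseq undup_id. Qed.

Lemma nb_part_ge M n :
  (\sum_(0 <= i < M) size (part_enum (e i) (2 * M) n) <= nb_part C n)%N.
Proof.
rewrite -size_enum -size_fset_enum; apply: fsubset_leq_card.
apply/fsubsetP => la; rewrite in_fset_set; last exact: finite_part_of.
by rewrite in_fset /= => /enum_sub h; apply: mem_set.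
Qed.

Lemma nb_part_eq M n : (n < M)%N ->
  (\sum_(0 <= i < M) size (part_enum (e i) (2 * M) n) = nb_part C n)%N.
Proof.
move=> nM; apply/eqP; rewrite eqn_leq nb_part_ge -size_enum -size_fset_enum /=.
apply: fsubset_leq_card; apply/fsubsetP => la.
rewrite in_fset_set; last exact: finite_part_of.
by move=> /set_mem h; rewrite in_fset /=; apply: sub_enum.
Qed.

Lemma gf_nb_part (K : numFieldType) (F : K -> K) : abs_complete K ->
  (forall q : K, `|q| < 1 -> \sum_(0 <= i < M)
    \prod_(0 <= j < 2 * M) mult_factor q j.+1 (e i j.+1) @[M --> \oo] --> F q) ->
  gf (nb_part C) F.
Proof.
move=> hK; apply: (gf_limit hK
   (A := fun M n => (\sum_(0 <= i < M) size (part_enum (e i) (2 * M) n))%N)).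
- by move=> M; apply: gf_sum => i _; exact: gf_part_enum.
- exact: nb_part_ge.
- by move=> M n nM; rewrite nb_part_eq.
Qed.

End Counting.

(** * Parity profiles and conjugation *)

Section Profiles.
Local Open Scope nat_scope.
Implicit Types (la : seq nat).

(* Multiplicities of a partition in EO2 with smallest odd part [2 i + 1], and of
   one in EO3 with largest part [2 i + 1]. *)
Definition EO2_profile (i j : nat) : option bool :=
  if j == (2 * i).+1 then Some true
  else if odd j == ((2 * i).+1 < j) then Some false else None.

Definition EO3_profile (i j : nat) : option bool :=
  if j == (2 * i).+1 then Some true
  else if odd j && (j < (2 * i).+1) then Some false else None.

Lemma part_pos la a : is_part la -> a \in la -> 0 < a.
Proof. by case=> _; apply. Qed.

Lemma aont_in la a : aont la a -> a \in la.
Proof. by rewrite /aont; apply: contraTT => /count_memPn ->. Qed.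

Lemma mult_ok_odd o la a : mult_ok o (count_mem a la) -> aont la a -> o = Some true.
Proof. by rewrite /aont; case: o => [b|] /= /eqP -> //; case: b. Qed.

Lemma mult_ok_in o la a : mult_ok o (count_mem a la) -> a \in la -> o <> None.
Proof. by case: o => [b|] //= /eqP/count_memPn/negP. Qed.

(** With smallest odd part [a], the order condition admits besides [a] just the even sizes below [a]
    and the odd ones above, that is, [odd j = (a < j)]. *)
Lemma EO2_mult la : is_part la -> EO2 la <->
  exists i, forall j, 0 < j -> mult_ok (EO2_profile i j) (count_mem j la).
Proof.
move=> pl; split.
  case=> -[_ ltEO] [a [al oa amin] aontE]; exists a./2.
  have aE : (2 * a./2).+1 = a by rewrite mul2n -[RHS]odd_double_half oa.
  move=> j j0; rewrite /EO2_profile aE; have [->|ja] := eqVneq j a.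
    by rewrite /= eqb_id; apply/aontE.
  have ev : ~~ odd (count_mem j la) by apply/negP => /aontE /eqP; rewrite (negbTE ja).
  case: ifPn => [_|jo] /=; first by rewrite eqbF_neg.
  apply/eqP/count_memPn/negP => jl; case oj : (odd j) jo.
    by rewrite ltn_neqAle [a == j]eq_sym ja amin ?oj.
  by rewrite ltnNge ltnW ?ltEO ?oj.
case=> i ok; set a := (2 * i).+1.
have oa : odd a by rewrite /a /= mul2n odd_double.
have aa : aont la a by have := ok a isT; rewrite /EO2_profile eqxx => /eqP.
have prof j : j \in la -> j = a \/ odd j = (a < j).
  move=> jl; have := mult_ok_in (ok j (part_pos pl jl)) jl.
  by rewrite /EO2_profile; case: eqP => [->|_]; [left | case: eqP => //; right].
split; first split => //.
  move=> x y xl yl ox oy.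
  have [xa|ex] := prof x xl; first by rewrite xa oa in ox.
  have xa : x < a.
    by rewrite ltn_neqAle leqNgt -ex ox andbT; apply: contraNneq ox => ->.
  by have [->|ey] := prof y yl => //; apply: ltn_trans xa _; rewrite -ey.
exists a; first split => //; first exact: aont_in.
  by move=> b bl ob; have [->|] := prof b bl => //; rewrite ob => /esym/ltnW.
move=> b; split => [ab|->//].
have := mult_ok_odd (ok b (part_pos pl (aont_in ab))) ab.
by rewrite /EO2_profile; case: eqP => // _; case: ifP.
Qed.

Lemma EO3_mult la : is_part la -> EO3 la <->
  exists i, forall j, 0 < j -> mult_ok (EO3_profile i j) (count_mem j la).
Proof.
move=> pl; split.
  case=> _ allodd [a [al oa amax] aontE]; exists a./2.
  have aE : (2 * a./2).+1 = a by rewrite mul2n -[RHS]odd_double_half oa.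
  move=> j j0; rewrite /EO3_profile aE; have [->|ja] := eqVneq j a.
    by rewrite /= eqb_id; apply/aontE.
  have ev : ~~ odd (count_mem j la) by apply/negP => /aontE /eqP; rewrite (negbTE ja).
  case: ifPn => [_|jo] /=; first by rewrite eqbF_neg.
  apply/eqP/count_memPn/negP => jl; move: jo.
  by rewrite allodd //= ltn_neqAle ja amax ?allodd.
case=> i ok; set a := (2 * i).+1.
have oa : odd a by rewrite /a /= mul2n odd_double.
have aa : aont la a by have := ok a isT; rewrite /EO3_profile eqxx => /eqP.
have prof j : j \in la -> odd j /\ j <= a.
  move=> jl; have := mult_ok_in (ok j (part_pos pl jl)) jl.
  rewrite /EO3_profile; case: eqP => [->//|_].
  by case: ifP => // /andP[oj /ltnW].
split; first split => //.
- by move=> x y /prof[ox _] _; rewrite ox.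
- by move=> x /prof[].
exists a; first by split => //; [exact: aont_in | move=> b /prof[]].
move=> b; split => [ab|->//].
have := mult_ok_odd (ok b (part_pos pl (aont_in ab))) ab.
by rewrite /EO3_profile; case: eqP => // _; case: ifP.
Qed.

Lemma EO2_profile_odd i j : 0 < j -> (EO2_profile i j == Some true) = (j == (2 * i).+1).
Proof. by rewrite /EO2_profile; case: (j == _) => //; case: ifP. Qed.

Lemma EO3_profile_odd i j : 0 < j -> (EO3_profile i j == Some true) = (j == (2 * i).+1).
Proof. by rewrite /EO3_profile; case: (j == _) => //; case: ifP. Qed.

Lemma EO2_profile_lt i i' : i < i' -> EO2_profile i' (2 * i).+1 = None.
Proof.
move=> ii'; rewrite /EO2_profile /= mul2n odd_double -mul2n.
by rewrite ltn_eqF ?ifF //; lia.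
Qed.

Lemma EO3_profile_lt i i' : i < i' -> EO3_profile i (2 * i').+1 = None.
Proof. by move=> ii'; rewrite /EO3_profile gtn_eqF ?ifF //; lia. Qed.

End Profiles.

(** * Stability under conjugation through parity prefixes *)

Section Stability.
Local Open Scope nat_scope.
Implicit Types (la : seq nat).

Lemma part_nth_le la i j : is_part la -> i <= j -> nth 0 la j <= nth 0 la i.
Proof.
move=> [sl _] ij; have [jl|lj] := ltnP j (size la); last by rewrite nth_default.
by apply: (sorted_leq_nth (rev_trans leq_trans) leqnn _ sl) => //; rewrite inE ?(leq_ltn_trans ij).
Qed.

(** Using the reflection in [conj_partP] twice shows that the entries agree; since all parts are
    positive, the entries determine the length. *)
Lemma conj_partK la : is_part la -> conj_part (conj_part la) = la.
Proof.
move=> pl; have [pc cE] := conj_partP pl; have [pcc ccE] := conj_partP pc.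
have nthE i : nth 0 (conj_part (conj_part la)) i = nth 0 la i.
  have lt j : (j < nth 0 (conj_part (conj_part la)) i) = (j < nth 0 la i).
    by rewrite ccE cE.
  apply/eqP; rewrite eqn_leq; apply/andP; split.
    by rewrite leqNgt lt ltnn.
  by rewrite leqNgt -lt ltnn.
have sizeE s : is_part s -> forall i, (i < size s) = (0 < nth 0 s i).
  move=> [_ pos] i; have [il|li] := ltnP i (size s); last by rewrite nth_default.
  by rewrite pos ?mem_nth.
apply: (@eq_from_nth _ 0) => //.
apply/eqP; rewrite eqn_leq; apply/andP; split; rewrite leqNgt.
  by rewrite (sizeE _ pcc) nthE -(sizeE _ pl) ltnn.
by rewrite (sizeE _ pl) -nthE -(sizeE _ pcc) ltnn.
Qed.

Lemma nth_conj_part la j : is_part la -> nth 0 (conj_part la) j = count (fun a => j < a) la.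
Proof.
move=> [sl _]; have [jm|mj] := ltnP j (head 0 la); first by rewrite nth_mkseq.
rewrite nth_default ?size_mkseq //; apply/esym/eqP; rewrite -leqn0 leqNgt -has_count.
apply/hasPn => a al; rewrite -leqNgt (leq_trans _ mj) //.
case: la sl al {mj} => //= b s; rewrite (path_sortedE (rev_trans leq_trans)) => /andP[/allP h _].
by rewrite inE => /orP[/eqP ->|/h].
Qed.

(** The multiplicity of [a] is the difference of the conjugate parts number [a] and [a + 1], at
    positions [a.-1] and [a] counted from 0. *)
Lemma aontE la a : is_part la -> 0 < a ->
  odd (count_mem a la) = (odd (nth 0 (conj_part la) a.-1) != odd (nth 0 (conj_part la) a)).
Proof.
case: a => // a pl _; rewrite !nth_conj_part //=.
have -> : count (fun x => a < x) la = count_mem a.+1 la + count (fun x => a.+1 < x) la.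
  rewrite -count_predUI [X in _ = _ + X](_ : _ = 0) ?addn0.
    by apply: eq_count => x /=; rewrite [LHS]leq_eqVlt eq_sym.
  apply/eqP; rewrite -leqn0 leqNgt -has_count; apply/hasPn => x _ /=.
  by case: eqP => // ->; rewrite ltnn.
by rewrite oddD; case: (odd _); case: (odd _).
Qed.

(** Applied to [nth 0 la], whose padding by 0 is even, so positions past the end obey the same
    rule. *)
Definition odd_prefix (f : nat -> nat) (k : nat) : Prop := forall i, odd (f i) = (i < k).

Lemma EO_prefix la : is_part la -> EO la <-> exists k, odd_prefix (nth 0 la) k.
Proof.
move=> pl; split=> [[_ ltEO]|[k ok]].
  exists (find (predC odd) la) => i; have [ik|ki] := ltnP i (find (predC odd) la).
    by have := before_find 0 ik => /= /negbFE.
  have [il|li] := ltnP i (size la); last by rewrite nth_default.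
  have hasev : has (predC odd) la by rewrite has_find (leq_ltn_trans ki).
  apply/negP => oi; have := ltEO _ _ (mem_nth 0 (leq_ltn_trans ki il)) (mem_nth 0 il)
    (nth_find 0 hasev) oi.
  by rewrite ltnNge part_nth_le.
split => // a b /(nthP 0)[i il <-] /(nthP 0)[j jl <-]; rewrite !ok -leqNgt => ki jk.
rewrite ltn_neqAle (part_nth_le pl) ?andbT; last exact: leq_trans (ltnW jk) ki.
by apply/eqP => /(congr1 odd); rewrite !ok jk ltnNge ki.
Qed.

(** By [aontE] a size appears an odd number of times where the parity of the conjugate changes,
    which happens only at [k]; for [k = 0] there is no such size. *)
Lemma aont_prefix la k a : is_part la -> odd_prefix (nth 0 (conj_part la)) k ->
  aont la a <-> 0 < a /\ a = k.
Proof.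
move=> pl ok; case: a => [|a].
  split=> [/aont_in /(part_pos pl)//|[]//].
rewrite /aont aontE // !ok /=; split => [h|[_ ->]]; last by lia.
by split => //; lia.
Qed.

Lemma odd_change (f : nat -> nat) i j : i <= j -> odd (f i) != odd (f j) ->
  exists2 t, i <= t < j & odd (f t) != odd (f t.+1).
Proof.
elim: j => [|j IH]; first by rewrite leqn0 => /eqP ->; rewrite eqxx.
rewrite leq_eqVlt => /orP[/eqP ->|]; first by rewrite eqxx.
rewrite ltnS => ij h; have [e|n] := eqVneq (odd (f j)) (odd (f j.+1)).
  rewrite -e in h; have [t /andP[it tj] ht] := IH ij h.
  by exists t => //; rewrite it leqW.
by exists j => //; rewrite ij ltnSn.
Qed.

(** If an even conjugate part preceded an odd one, the parity would change before the odd part and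
    again after it, giving two such sizes. *)
Lemma aont_le1_prefix la : is_part la ->
  (forall a b, aont la a -> aont la b -> a = b) <->
  exists k, odd_prefix (nth 0 (conj_part la)) k.
Proof.
move=> pl; have [pc _] := conj_partP pl; split; last first.
  by move=> [k ok] a b /(aont_prefix _ pl ok)[_ ->] /(aont_prefix _ pl ok)[_ ->].
move=> uniq_aont; apply/(EO_prefix pc); split => //.
move=> _ _ /(nthP 0)[i il <-] /(nthP 0)[j jl <-] oi oj.
rewrite ltnNge; apply/negP => le_ji.
have ij : i < j.
  rewrite ltnNge; apply/negP => /(part_nth_le pc); rewrite leq_eqVlt ltnNge le_ji orbF.
  by move=> /eqP e; rewrite e oj in oi.
have [t /andP[_ tj] ht] : exists2 t, i <= t < j &
    odd (nth 0 (conj_part la) t) != odd (nth 0 (conj_part la) t.+1).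
  by apply: odd_change; [exact: ltnW | rewrite (negbTE oi) oj].
(* Past the last part the entries are 0, hence even, which forces a second change at or after
   [j]. *)
have [u /andP[ju _] hu] : exists2 u, j <= u < size (conj_part la) &
    odd (nth 0 (conj_part la) u) != odd (nth 0 (conj_part la) u.+1).
  by apply: odd_change; [exact: ltnW | rewrite oj [X in odd X]nth_default].
have /eq_add_S tu : t.+1 = u.+1 by apply: uniq_aont; rewrite /aont aontE.
by rewrite tu ltnNge ju in tj.
Qed.

Lemma EO1_prefix la : is_part la -> EO1 la <->
  (exists k, odd_prefix (nth 0 la) k) /\ (exists k, odd_prefix (nth 0 (conj_part la)) k).
Proof.
move=> pl; split=> [[/(EO_prefix pl) h1 /(aont_le1_prefix pl) h2]//|].
by move=> [/(EO_prefix pl) h1 /(aont_le1_prefix pl) h2].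
Qed.

(** Position [i] holds the smallest odd part and [j.+1] is the only size of odd multiplicity, so the
    equation makes them equal. Geometrically, cell [(i, j)] ends its row. *)
Lemma EO2_prefix la : is_part la -> EO2 la <-> exists i j,
  [/\ odd_prefix (nth 0 la) i.+1, odd_prefix (nth 0 (conj_part la)) j.+1 & nth 0 la i = j.+1].
Proof.
move=> pl; split.
  case=> /(EO_prefix pl)[k ok] [a [al oa amin] aE].
  have /(aont_le1_prefix pl)[k' ok'] : forall x y, aont la x -> aont la y -> x = y.
    by move=> x y /aE -> /aE ->.
  have [a0 ak'] : 0 < a /\ a = k' by apply/(aont_prefix a pl ok')/aE.
  move: al => /(nthP 0)[i il ia]; have ik : i < k by rewrite -ok ia.
  case: k ok ik => // k ok ik; case: k' ok' ak' => [|j] ok' aj; first by rewrite aj in a0.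
  exists k, j; split => //; apply/eqP; rewrite eqn_leq -aj.
  have ok_k : odd (nth 0 la k) by rewrite ok.
  rewrite amin // ?andbT; first by rewrite -ia part_nth_le.
  by rewrite mem_nth // ltnNge; apply/negP => h; rewrite nth_default in ok_k.
case=> i [j [ok ok' ij]].
have jl : j.+1 \in la.
  rewrite -ij mem_nth // ltnNge; apply/negP => h.
  by move: ij; rewrite nth_default.
split; first by apply/EO_prefix => //; exists i.+1.
exists j.+1; last first.
  by move=> b; rewrite (aont_prefix b pl ok'); split=> [[]|->].
split => //; first by rewrite -ij ok.
move=> _ /(nthP 0)[t tl <-]; rewrite ok ltnS => ti.
by rewrite -ij part_nth_le.
Qed.

(** Entry 0 of the conjugate is the number of parts, so the first prefix says that all parts are
    odd; by [aont_prefix] the second singles out the largest part. *)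
Lemma EO3_prefix la : is_part la -> EO3 la <->
  [/\ la <> [::], odd_prefix (nth 0 la) (nth 0 (conj_part la) 0) &
      odd_prefix (nth 0 (conj_part la)) (nth 0 la 0)].
Proof.
move=> pl; have [pc cE] := conj_partP pl.
have sizeE i : (i < size la) = (i < nth 0 (conj_part la) 0).
  rewrite cE; have [il|li] := ltnP i (size la); last by rewrite nth_default.
  by rewrite (part_pos pl) ?mem_nth.
split.
  case=> EOla allodd [a [al oa amax] aE].
  have /(aont_le1_prefix pl)[k' ok'] : forall x y, aont la x -> aont la y -> x = y.
    by move=> x y /aE -> /aE ->.
  have [a0 ak'] : 0 < a /\ a = k' by apply/(aont_prefix a pl ok')/aE.
  have la0 : 0 < size la by case: (la) al.
  split; first by move=> e; rewrite e in al.
    move=> i; rewrite -sizeE; have [il|li] := ltnP i (size la).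
      by rewrite allodd ?mem_nth.
    by rewrite nth_default.
  suff -> : nth 0 la 0 = k' by [].
  rewrite -ak'; apply/eqP; rewrite eqn_leq amax ?mem_nth ?allodd ?mem_nth //=.
  by move: al => /(nthP 0)[i _ <-]; apply: part_nth_le.
case=> la0 ok ok'.
have la0' : 0 < size la by case: (la) la0.
have odd_all a : a \in la -> odd a.
  by move=> /(nthP 0)[i il <-]; rewrite ok -sizeE.
split => //; first by apply/EO_prefix => //; eexists; exact: ok.
exists (nth 0 la 0).
  split; rewrite ?odd_all ?mem_nth //.
  by move=> _ /(nthP 0)[i il <-] _; apply: part_nth_le.
move=> b; rewrite (aont_prefix b pl ok'); split=> [[]//|->]; split => //.
by rewrite (part_pos pl) ?mem_nth.
Qed.

Lemma stable_of_imp (C : set (seq nat)) :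
  (forall la, is_part la -> C la -> C (conj_part la)) -> stable C.
Proof.
move=> h la pl; split; first exact: h.
by have [pc _] := conj_partP pl => /(h _ pc); rewrite conj_partK.
Qed.

Lemma EO1_stable : stable EO1.
Proof.
apply: stable_of_imp => la pl; have [pc _] := conj_partP pl.
by move=> /(EO1_prefix pl)[h1 h2]; apply/(EO1_prefix pc); rewrite conj_partK.
Qed.

Lemma EO2_stable : stable EO2.
Proof.
apply: stable_of_imp => la pl; have [pc cE] := conj_partP pl.
move=> /(EO2_prefix pl)[i [j [ok ok' ij]]]; apply/(EO2_prefix pc).
exists j, i; rewrite conj_partK //; split => //.
(* A later row reaching column [j] would have length exactly [j.+1], which is odd, whereas rows
   after [i] are even. So cell [(i, j)] also ends its column. *)
have lt t : (t < nth 0 (conj_part la) j) = (t < i.+1).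
  rewrite cE; apply/idP/idP => [jt|ti].
    rewrite ltnNge; apply/negP => it.
    have : nth 0 la t = j.+1.
      by apply/eqP; rewrite eqn_leq jt -ij part_nth_le // ltnW.
    by move=> e; have := ok t; rewrite e -ij ok ltnSn ltnNge it.
  by have := part_nth_le pl (ti : t <= i); rewrite ij.
apply/eqP; rewrite eqn_leq; apply/andP; split.
  by rewrite leqNgt lt ltnn.
by rewrite lt.
Qed.

Lemma EO3_stable : stable EO3.
Proof.
apply: stable_of_imp => la pl; have [pc cE] := conj_partP pl.
move=> /(EO3_prefix pl)[la0 ok ok']; apply/(EO3_prefix pc).
rewrite conj_partK //; split => // c0; apply: la0.
by rewrite -(conj_partK pl) c0.
Qed.

End Stability.

(** * Generating functions *)

Section MultiplicityProducts.
Variable K : numFieldType.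
Hypothesis hK : abs_complete K.
Variable q : K.
Hypothesis q1 : `|q| < 1.

Let z : K := q ^+ 2.

Let z1 : `|z| < 1.
Proof. by rewrite normrX exprn_ilt1. Qed.

Let expr_lt1 (x : K) n : `|x| < 1 -> 1 - x ^+ n.+1 != 0.
Proof.
move=> x1; rewrite subr_eq0; apply/eqP => xn.
by have := exprn_ilt1 n.+1 (normr_ge0 x) x1; rewrite -normrX -xn normr1 ltxx.
Qed.

Let odd_factor k : q ^+ (2 * (2 * k).+1) = z * z ^+ 2 ^+ k.
Proof. by rewrite /z -!exprM -exprD; congr (_ ^+ _); lia. Qed.

Let even_factor k : q ^+ (2 * (2 * k).+2) = z * z * z ^+ 2 ^+ k.
Proof. by rewrite /z -!exprM -!exprD; congr (_ ^+ _); lia. Qed.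

Let factor_odd_neq0 k : 1 - z * z ^+ 2 ^+ k != 0.
Proof. by rewrite -odd_factor mulnS; apply: expr_lt1. Qed.

Lemma prod_nat_pairs (f : nat -> K) M :
  \prod_(0 <= j < 2 * M) f j = \prod_(0 <= k < M) (f (2 * k)%N * f (2 * k).+1).
Proof.
elim: M => [|M IH]; first by rewrite !big_geq.
by rewrite mulnS !big_nat_recr //= IH mulrA.
Qed.

Let EO3_profile_gt i j : ((2 * i).+1 < j)%N -> EO3_profile i j = None.
Proof. by move=> ij; rewrite /EO3_profile gtn_eqF // ltnNge ltnW // andbF. Qed.

Lemma sum_nat_pairs (f : nat -> K) M :
  \sum_(0 <= j < 2 * M) f j = \sum_(0 <= k < M) (f (2 * k)%N + f (2 * k).+1).
Proof.
elim: M => [|M IH]; first by rewrite !big_geq.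
by rewrite mulnS !big_nat_recr //= IH addrA.
Qed.

(** Only the odd sizes up to [2 * i + 1] contribute: their denominators form the product, and the
    odd multiplicity of the last gives [q ^+ (2 * i).+1 = q * z ^+ i]. *)
Lemma EO3_product M i : (i < M)%N ->
  \prod_(0 <= j < 2 * M) mult_factor q j.+1 (EO3_profile i j.+1)
    = q * omega_term z z i.
Proof.
move=> iM; rewrite prod_nat_pairs (big_cat_nat (n := i.+1)) //=.
rewrite [X in _ * X]big_nat [X in _ * X]big1 ?mulr1; last first.
  move=> k /andP[ik _]; rewrite [EO3_profile _ (_ * _).+1]EO3_profile_gt; last lia.
  by rewrite EO3_profile_gt ?mulr1 //; lia.
have pairE k : (k < i.+1)%N ->
    mult_factor q (2 * k).+1 (EO3_profile i (2 * k).+1) *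
    mult_factor q (2 * k).+2 (EO3_profile i (2 * k).+2) =
    (if k == i then q * z ^+ i else 1) * (1 - z * z ^+ 2 ^+ k)^-1.
  move=> ki; rewrite [X in _ * X](_ : _ = 1) ?mulr1; last first.
    rewrite /EO3_profile (_ : (_ == _) = false) /= ?mul2n ?odd_double //.
    by rewrite !eqSS -!mul2n; lia.
  rewrite /EO3_profile eqSS eqn_pmul2l //; case: eqP => [->|/eqP ne].
    by rewrite /= mul1n odd_factor exprS exprM.
  rewrite ifT; last by rewrite /= mul2n odd_double /=; lia.
  by rewrite /= odd_factor mul0n expr0.
rewrite (eq_big_nat _ _ (F2 := fun k => (if k == i then q * z ^+ i else 1) *
   (1 - z * z ^+ 2 ^+ k)^-1)); last by move=> k /andP[_ /pairE].
rewrite big_split /= prodfV -/(qprod _ _ _) /omega_term mulrA; congr (_ / _).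
rewrite big_nat_recr //= eqxx big_nat big1 ?mul1r // => k /andP[_ ki].
by rewrite ltn_eqF.
Qed.

(** Even sizes below [2 * i + 1] give the lower product of [psi_term]. Its upper product cancels, in
    the common denominator over all odd sizes, those below [2 * i + 1]. *)
Lemma EO2_product M i : (i < M)%N ->
  \prod_(0 <= j < 2 * M) mult_factor q j.+1 (EO2_profile i j.+1)
    = q * psi_term z z i / qprod z (z ^+ 2) M.
Proof.
move=> iM; rewrite prod_nat_pairs.
have pairE k : mult_factor q (2 * k).+1 (EO2_profile i (2 * k).+1) *
    mult_factor q (2 * k).+2 (EO2_profile i (2 * k).+2) =
    (if (k < i)%N then (1 - z * z ^+ 2 ^+ k) / (1 - z * z * z ^+ 2 ^+ k)
     else if k == i then q * z ^+ i else 1) * (1 - z * z ^+ 2 ^+ k)^-1.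
  rewrite /EO2_profile eqSS eqn_pmul2l // [X in _ * mult_factor _ _ X]ifF; last lia.
  rewrite /= mul2n odd_double -mul2n /=.
  case: (ltngtP k i) => [ki|ik|->] /=.
  - rewrite [X in mult_factor _ (2 * k).+1 X]ifF; last lia.
    rewrite [X in _ * mult_factor _ _ X]ifT; last lia.
    by rewrite /= even_factor mul0n expr0 !mul1r [RHS]mulrAC mulfV // mul1r.
  - rewrite [X in mult_factor _ (2 * k).+1 X]ifT; last lia.
    rewrite [X in _ * mult_factor _ _ X]ifF; last lia.
    by rewrite /= odd_factor mul0n expr0 mulr1.
  rewrite [X in _ * mult_factor _ _ X]ifF; last lia.
  by rewrite /= odd_factor mul1n mulr1 exprS exprM.
under eq_bigr do rewrite pairE.
rewrite big_split /= prodfV -/(qprod _ _ _); congr (_ / _).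
rewrite (big_cat_nat (n := i)) //=; last exact: ltnW.
rewrite [X in _ * X]big_ltn // ltnn eqxx [X in _ * (_ * X)]big_nat.
rewrite [X in _ * (_ * X)]big1 ?mulr1; last first.
  by move=> k /andP[ik _]; rewrite ltnNge ltnW //= gtn_eqF.
rewrite (eq_big_nat _ _ (F2 := fun k => (1 - z * z ^+ 2 ^+ k) * (1 - z * z * z ^+ 2 ^+ k)^-1));
  last by move=> k /andP[_ ->].
rewrite big_split /= prodfV -!/(qprod _ _ _) /psi_term.
by rewrite mulrCA [X in q * X = _]mulrAC.
Qed.

(** At [y = 0] the denominators are 1, and the partial sums of even length are the paired triangular
    sums. *)
Lemma nu_sum_0_psi : nu_sum q 0 = psi_sum z z.
Proof.
have z0 : `|0 : K| <= `|q| by rewrite normr0.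
apply: (cvg_unique (@norm_hausdorff _ _) _ (psi_sum_pairs_cvg hK z1)).
rewrite [X in X @ _](_ : _ = series (nu_term q 0) \o muln 2).
  apply: (cvg_comp _ _ _ (nu_sum_cvg hK q1 z0)).
  by move=> P [N _ NP]; exists N => // n /= Nn; apply: NP => /=; lia.
apply/funext => k; rewrite /series /= sum_nat_pairs; apply: eq_bigr => n _.
rewrite /nu_term oppr0 !qprod0l !divr1 /z -!exprM.
by congr (_ ^+ _ + _ ^+ _); lia.
Qed.

Lemma EO2_product_cvg : \sum_(0 <= i < M)
    \prod_(0 <= j < 2 * M) mult_factor q j.+1 (EO2_profile i j.+1) @[M --> \oo]
  --> 2^-1 * q * (nu_sum q q + nu_sum q (- q)).
Proof.
have [B B0 hB] := qprod_bounds hK (normr_ge0 z) z1.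
have z2_le : `|z ^+ 2| <= `|z| by rewrite normrX; apply: ler_iXnr => //; exact: ltW.
have nz n : qprod z (z ^+ 2) n != 0 by have [] := hB z (z ^+ 2) n (lexx _) z2_le.
pose T k := nu_sum q (q ^+ (2 * k).+1) + nu_sum q (- q ^+ (2 * k).+1).
(* By [nu_sumN_iter] the product times the sum of both nu values is exactly [T M], so the distance
   to the limit is a bounded inverse times a null sequence. *)
rewrite [X in X @ _](_ : _ = (fun M => q * ((qprod z (z ^+ 2) M)^-1 *
    (series (psi_term z z) M - 2^-1 * T M)) + 2^-1 * q * (nu_sum q q + nu_sum q (- q)))).
  rewrite -[X in _ --> X]add0r; apply: cvgD; last exact: cvg_cst.
  apply: cvgMl0; apply: (cvgM_bounded0 (B := B)) => [n|].
    by have [] := hB z (z ^+ 2) n (lexx _) z2_le.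
  rewrite -[X in _ --> X](subrr (psi_sum z z)); apply: cvgB.
    exact: psi_sum_cvg.
  rewrite -[psi_sum z z](@mulKf _ 2) ?pnatr_eq0 // -nu_sum_0_psi.
  by apply: cvgM; [exact: cvg_cst | exact: nu_sumN_cvg].
apply/funext => M; rewrite (eq_big_nat _ _ (F2 := fun i =>
  q * psi_term z z i / qprod z (z ^+ 2) M)); last by move=> i /andP[_ /EO2_product].
rewrite -mulr_suml -mulr_sumr -[\sum_(0 <= i < M) _]/(series (psi_term z z) M) /T -nu_sumN_iter // (exprM q 2 2) -/z.
by move: (nz M); move: (series _ _) (nu_sum q q) (nu_sum q (- q)) (qprod _ _ _) => S a b D D0; field.
Qed.

Lemma EO3_product_cvg : \sum_(0 <= i < M)
    \prod_(0 <= j < 2 * M) mult_factor q j.+1 (EO3_profile i j.+1) @[M --> \oo]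
  --> q * omega_sum z z.
Proof.
rewrite [X in X @ _](_ : _ = (fun M => q * series (omega_term z z) M)).
  by apply: cvgM; [exact: cvg_cst | exact: omega_sum_cvg].
apply/funext => M; rewrite /series /= mulr_sumr; apply: eq_big_nat => i /andP[_].
exact: EO3_product.
Qed.

End MultiplicityProducts.

(** * Identification with the mock theta functions *)

Section MockThetaLink.
Variable R : realType.
Local Notation C := (R[i] : numFieldType).
Implicit Types q : C.

Lemma nu_nu_sum q : nu q = nu_sum q q.
Proof. by []. Qed.

(** As [n ^ 2 + n] is even, replacing [q] by [- q] only changes the sign of the base point. *)
Lemma nuN_nu_sum q : nu (- q) = nu_sum q (- q).
Proof.
rewrite /nu /nu_sum (_ : (fun n => _) = nu_term q (- q)) //; apply/funext => n.
rewrite /nu_term sqrrN; congr (_ / _).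
rewrite exprNn -signr_odd (_ : odd (n ^ 2 + n) = false) ?mul1r //.
by rewrite oddD oddX /= addbb.
Qed.

Lemma omega_omega_sum q : `|q| < 1 -> omega q = omega_sum q q.
Proof.
move=> q1; rewrite /omega.
exact: (cvg_lim (@norm_hausdorff _ _) (omega_series_cvg (@complex_complete R) q1)).
Qed.

End MockThetaLink.

Theorem theorem3p5 (R : realType) :
  [/\ stable EO1, stable EO2 & stable EO3] /\
  forall q : (R[i] : numFieldType), `|q| < 1 ->
    (\sum_(1 <= n < N) (nb_part EO2 n)%:R * q ^+ n @[N --> \oo]
       --> 2^-1 * q * (nu q + nu (- q))) /\
    (\sum_(1 <= n < N) (nb_part EO3 n)%:R * q ^+ n @[N --> \oo]
       --> q * omega (q ^+ 2)).
Proof.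
split; first by split; [exact: EO1_stable | exact: EO2_stable | exact: EO3_stable].
(* The only partition of 0 is the empty one, which has no odd part and so lies in neither set:
   starting the sum at 1 loses nothing. *)
have drop0 (C : set (seq nat)) (q : (R[i] : numFieldType)) l : ~ C [::] ->
    \sum_(0 <= n < N) (nb_part C n)%:R * q ^+ n @[N --> \oo] --> l ->
    \sum_(1 <= n < N) (nb_part C n)%:R * q ^+ n @[N --> \oo] --> l.
  move=> C0; have nb0 : nb_part C 0 = 0%N.
    rewrite /nb_part (_ : [set la | _] = set0) ?fset_set0 ?cardfs0 //.
    apply/seteqP; split => // la [pl sn Cla]; apply: C0.
    case: la pl sn Cla => // a la [_ pos] /eqP; rewrite /= addn_eq0 => /andP[/eqP a0 _].
    by have := pos a (mem_head _ _); rewrite a0.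
  rewrite -(cvg_shiftS (fun N => \sum_(0 <= n < N) _)) -(cvg_shiftS (fun N => \sum_(1 <= n < N) _)).
  by under eq_cvg do rewrite /= big_ltn // nb0 mul0r add0r.
have hK := @complex_complete R.
move=> q q1; have z1 : `|q ^+ 2| < 1 by rewrite normrX exprn_ilt1.
split; apply: drop0.
- by case=> _ [a []].
- rewrite nuN_nu_sum nu_nu_sum.
  apply: (gf_nb_part EO2_mult EO2_profile_odd _ hK
    (F := fun q => 2^-1 * q * (nu_sum q q + nu_sum q (- q)))) => // [i i' /EO2_profile_lt|p p1].
    by left.
  exact: EO2_product_cvg.
- by case=> _ _ [a []].
rewrite omega_omega_sum //.
apply: (gf_nb_part EO3_mult EO3_profile_odd _ hK
  (F := fun q => q * omega_sum (q ^+ 2) (q ^+ 2))) => // [i i' /EO3_profile_lt|p p1].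
  by right.
exact: EO3_product_cvg.
Qed.
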